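(* Let $\lambda$ be a Dyck path and $A(\lambda)$ its tree. For each vertex $v$ of $A(\lambda)$ (including the root) let $e_1,\dots,e_k$ be the edges directly below $v$, let $N_{v,j}$ be the number of edges in the subtree consisting of $e_j$ and all edges below it, and $M_v=\sum_{j=1}^kN_{v,j}$. Then $$\sum_{D\in\mathcal{D}(\lambda/\ast)}q^{\mathrm{art}(D)}=\prod_{v}\genfrac{[}{]}{0pt}{}{M_v}{N_{v,1},\dots,N_{v,k}},$$ the product over all vertices $v$ having at least two edges directly below them (vertices with one child contribute a factor $1$).
   Context: $[n]=\sum_{i=0}^{n-1}q^i$, $[n]!=\prod_{i=1}^n[i]$, $\genfrac{[}{]}{0pt}{}{n}{k_1,\dots,k_r}=[n]!/\prod_i[k_i]!$ for $\sum k_i=n$. Paths: a path of length $L$ is a word in $\{U,D\}$, identified with the lattice path from $(0,0)$ with steps $U=(1,1)$, $D=(1,-1)$; $\lambda(x)$ is its height at $x$. A Dyck path of length $2n$ ends at height $0$ and never goes below $0$. Boxes: for integers $a,b$ with $a+b$ odd, the box centered at $(a,b)$ is the closed square with vertices $(a\pm1,b),(a,b\pm1)$. $Y(\lambda)$ is the set of boxes centered at $(a,b)$ with $b-1\ge\lambda(a)$, $b+1\le a$, $b+1\le 2n-a$. For Dyck paths $\mu$ weakly above $\lambda$, $\lambda/\mu=Y(\lambda)\setminus Y(\mu)$. A Dyck tile is a nonempty set of boxes whose centers listed left to right $c_0,\dots,c_{2k}$ satisfy $c_{i+1}-c_i\in\{(1,\pm1)\}$, none lower than $c_0$, $c_{2k}$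 at the height of $c_0$. A Dyck tiling of $\lambda/\mu$ is a partition into Dyck tiles; cover-inclusive means for every tile $\tau$, $\tau-(0,2)$ either lies entirely below $\lambda$ (each translated box has top vertex at or below $\lambda$) or is contained in a single tile. $\mathrm{art}(D)=(\#\text{boxes}+\#\text{tiles})/2$. $\mathcal{D}(\lambda/\ast)$: all cover-inclusive Dyck tilings of $\lambda/\mu$ over all Dyck paths $\mu$ weakly above $\lambda$. Tree $A(\lambda)$: chords are matched $U$–$D$ pairs (parenthesis matching); $A(\lambda)$ is the rooted plane tree with one edge per chord, the edge of chord $c$ hanging directly below the edge of the innermost chord strictly containing $c$, or from the root if there is none; siblings ordered left to right. *)

(* Defs.v *)
From HB Require Import structures.
From mathcomp Require Import all_boot all_order all_algebra.
Set Implicit Arguments. Unset Strict Implicit. Unset Printing Implicit Defensive.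
Import Order.TTheory GRing.Theory Num.Theory.

(* ---------- Paths: true = U, false = D ---------- *)

Definition ht (p : seq bool) (x : nat) : int :=
  Posz (count id (take x p)) - Posz (count negb (take x p)).

Definition dyck (p : seq bool) : bool :=
  all (fun x => (0 <= ht p x)%R) (iota 0 (size p).+1) && (ht p (size p) == 0).

(* ---------- Boxes (identified with their centers (a,b)) ---------- *)

Definition box (n : nat) := ('I_(n.*2.+1) * 'I_(n.*2.+1))%type.

Definition inY (n : nat) (p : seq bool) (c : box n) : bool :=
  [&& odd (c.1 + c.2), (ht p c.1 + 1 <= Posz (nat_of_ord c.2))%R,
      (c.2 + 1 <= c.1)%N & (c.1 + c.2 + 1 <= n.*2)%N].

Definition skew (n : nat) (lam mu : seq bool) : {set box n} :=
  [set c | inY lam c & ~~ inY mu c].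

Definition above (n : nat) (lam mu : seq bool) : bool :=
  all (fun x => (ht lam x <= ht mu x)%R) (iota 0 n.*2.+1).

Definition coords (n : nat) (c : box n) : nat * int :=
  (nat_of_ord c.1, Posz (nat_of_ord c.2)).

Definition tile_centers (a b : nat) (w : seq bool) : seq (nat * int) :=
  [seq (a + i, Posz b + ht w i)%R | i <- iota 0 (size w).+1].

(* t is a Dyck tile: its set of centers is exactly the centers
   c_0,...,c_{2k} of a Dyck word of length 2k started at some c_0.
   (Every center of a tile contained in the grid has coordinates < 2n+1,
   so bounding a, b and the length of w by 2n+1 loses nothing.) *)
Definition isDyckTile (n : nat) (t : {set box n}) : bool :=
  [exists a : 'I_(n.*2.+1), [exists b : 'I_(n.*2.+1),
   [exists k : 'I_(n.*2.+1), [exists w : k.-tuple bool,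
     dyck w &&
     (all (fun x => x \in tile_centers a b w) [seq coords c | c in t] &&
      all (fun x => x \in [seq coords c | c in t]) (tile_centers a b w))]]]].

Definition dyck_tiling (n : nat) (lam mu : seq bool) (D : {set {set box n}}) : bool :=
  partition D (skew n lam mu) && [forall t in D, isDyckTile t].

(* cover-inclusive: for every tile t, t - (0,2) lies entirely below lam
   (top vertex (a, b-1) of each translated box at or below lam), or is
   contained in a single tile of D *)
Definition cover_inclusive (n : nat) (lam : seq bool) (D : {set {set box n}}) : bool :=
  [forall t in D,
     [forall c in t, (Posz (nat_of_ord c.2) - 1 <= ht lam c.1)%R]
  || [exists t' in D, [forall c in t, [exists c' in t',
        (nat_of_ord c'.1 == c.1) && (c'.2 + 2 == c.2)%N]]]].

Definition art (n : nat) (D : {set {set box n}}) : nat :=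
  ((\sum_(t in D) #|t|) + #|D|)./2.

Local Open Scope ring_scope.

Definition tiling_gf (n : nat) (lam : seq bool) : {poly rat} :=
  \sum_(mu : (n.*2).-tuple bool | dyck mu && above n lam mu)
    \sum_(D : {set {set box n}} | dyck_tiling lam mu D && cover_inclusive lam D)
      'X^(art D).

Definition qint (k : nat) : {poly rat} := \sum_(i < k) 'X^i.
Definition qfact (k : nat) : {poly rat} := \prod_(i < k) qint i.+1.
(* q-multinomial [M; N_1,...,N_k] with M = N_1 + ... + N_k (exact division) *)
Definition qmultinom (ks : seq nat) : {poly rat} :=
  qfact (sumn ks) %/ \prod_(k <- ks) qfact k.

Definition matched (p : seq bool) (i j : nat) : bool :=
  [&& (i < j)%N, (j < size p)%N, nth false p i, ~~ nth false p j,
      ht p j.+1 == ht p i &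
      all (fun k => ht p k != ht p i) (iota i.+1 (j - i))].

Definition chords (p : seq bool) : seq (nat * nat) :=
  [seq x <- [seq (i, j) | i <- iota 0 (size p), j <- iota 0 (size p)]
     | matched p x.1 x.2].

Definition scontains (c d : nat * nat) : bool := (c.1 < d.1)%N && (d.2 < c.2)%N.

(* edges directly below vertex v (None = root, Some c = lower end of edge c) *)
Definition children (p : seq bool) (v : option (nat * nat)) : seq (nat * nat) :=
  match v with
  | None => [seq d <- chords p | ~~ has (fun c => scontains c d) (chords p)]
  | Some c => [seq d <- chords p | scontains c d &&
                 ~~ has (fun e => scontains c e && scontains e d) (chords p)]
  end.

Definition subtree_size (p : seq bool) (d : nat * nat) : nat :=
  count (fun e => (e == d) || scontains d e) (chords p).

Definition vertices (p : seq bool) : seq (option (nat * nat)) :=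
  None :: [seq Some c | c <- chords p].

Definition tree_product (p : seq bool) : {poly rat} :=
  \prod_(v <- vertices p | (2 <= size (children p v))%N)
     qmultinom [seq subtree_size p d | d <- children p v].

(* Main.v *)
Require Import Defs.
From mathcomp Require Import all_boot all_order all_algebra.
From mathcomp Require Import ring zify.
Set Implicit Arguments. Unset Strict Implicit. Unset Printing Implicit Defensive.
Import Order.TTheory GRing.Theory Num.Theory.

(** By cover-inclusiveness every tile is a Dyck segment of [lam] translated vertically by
    an odd amount [2k - 1], and it is contained, up to translation by [(0, -2)], in a
    tile of level [k - 1].  A tiling of [lam/mu] is therefore encoded by [mu] and by the
    numbers [t(c)] of tiles crossing the chords [c] of [lam].  These numbers weakly
    increase when passing to an inner chord and are bounded by the gap
    [g = (mu - lam)/2] at the endpoints of the steps of [c], and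
    [art = sum_x g(x) - sum_c t(c)].

    Reading [lam] from left to right turns the weighted count of codes into a transfer
    operator acting on functions [K] of the final gap.  With [e_n] the linear functional
    [K |-> sum_r qbin n r * q^(r(r+1)/2) * K r], the operator attached to a word [w] with
    [k] chords sends [e_n] to [F(w) * qbin (n+k) k * e_(n+k)], where [F(w)] is a constant.
    So [F] of a concatenation is a q-binomial coefficient times the product of the
    factors, enclosing a word in a chord does not change [F], and [F(lam)] is the value
    of the operator at the function [[r = 0]]. *)

(** * q-binomial coefficients and generating functions of forests *)

Section GeneratingFunctions.
Local Open Scope ring_scope.
Local Notation P := {poly rat}.

Lemma size_qint k : size (qint k) = k.
Proof.
have -> : qint k = \poly_(i < k) 1.
  by rewrite poly_def; apply: eq_bigr => i _; rewrite scale1r.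
by case: k => [|k]; [rewrite poly_def big_ord0 size_poly0 | rewrite size_poly_eq ?oner_eq0].
Qed.

Lemma qint_neq0 k : qint k.+1 != 0.
Proof. by rewrite -size_poly_eq0 size_qint. Qed.

Lemma qfactS k : qfact k.+1 = qfact k * qint k.+1.
Proof. by rewrite /qfact big_ord_recr. Qed.

Lemma qfact0 : qfact 0 = 1.
Proof. by rewrite /qfact big_ord0. Qed.

Lemma qfact_neq0 k : qfact k != 0.
Proof.
elim: k => [|k IH]; first by rewrite qfact0 oner_eq0.
by rewrite qfactS mulf_neq0 ?qint_neq0.
Qed.

Lemma qintD a b : qint (a + b) = qint b + 'X^b * qint a.
Proof.
rewrite /qint addnC big_split_ord /= mulr_sumr; congr (_ + _).
by apply: eq_bigr => i _; rewrite exprD.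
Qed.

(** The Gaussian binomial, given by a Pascal rule to avoid division. The truncated exponent is
    harmless: for [k' > n'] its factor [qbin n' k'] is 0. *)
Fixpoint qbin (n k : nat) : P :=
  match n, k with
  | _, 0 => 1
  | 0, _.+1 => 0
  | n'.+1, k'.+1 => qbin n' k'.+1 + 'X^(n' - k') * qbin n' k'
  end.

Lemma qbin0 n : qbin n 0 = 1. Proof. by case: n. Qed.

Lemma qbin_small n k : (n < k)%N -> qbin n k = 0.
Proof.
elim: n k => [|n IH] [|k] //= ltnk.
by rewrite !IH ?mulr0 ?addr0 // ltnW.
Qed.

(** Induction on [a + b]: multiplied by the factorials, the Pascal rule becomes [[a + b] = [a] + q^a
    [b]]. *)
Lemma qbin_fact a b : qbin (a + b) b * qfact a * qfact b = qfact (a + b).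
Proof.
move Em: (a + b)%N => m; elim: m a b Em => [|m IH] a b Em.
  have [-> ->] : a = 0%N /\ b = 0%N by lia.
  by rewrite !qfact0 !mulr1.
case: b Em => [|b] Em; first by rewrite qbin0 qfact0 mul1r mulr1 -Em addn0.
case: a Em => [|a] Em.
  have <- : b = m by lia.
  have := IH 0%N b ltac:(lia); have <- : b = m by lia.
  rewrite qfact0 mulr1 => H /=.
  by rewrite qbin_small // subnn expr0 add0r mul1r mulr1 qfactS mulrA H.
have H1 := IH a b.+1 ltac:(lia); have H2 := IH a.+1 b ltac:(lia).
have -> : qfact m.+1 = qfact m * qint (a.+1 + b.+1) by rewrite qfactS; congr (_ * qint _); lia.
rewrite [qbin m.+1 _]/= (_ : (m - b = a.+1)%N); last by lia.
transitivity (qbin m b.+1 * qfact a * qfact b.+1 * qint a.+1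
  + 'X^(a.+1) * (qbin m b * qfact a.+1 * qfact b) * qint b.+1).
  by rewrite !qfactS; ring.
by rewrite H1 H2 addnC qintD; ring.
Qed.

Lemma qbinn n : qbin n n = 1.
Proof. by apply: (mulIf (qfact_neq0 n)); rewrite mul1r -[RHS](@qbin_fact 0) qfact0 mulr1. Qed.

(** By induction with [qbin_fact], the product of the factorials divides [qfact] of the sum, so the
    quotient in [qmultinom] is exact. *)
Lemma qmultinom_cons k ks :
  qmultinom (k :: ks) = qbin (sumn ks + k) k * qmultinom ks.
Proof.
rewrite /qmultinom.
have exact s : exists c, qfact (sumn s) = c * \prod_(k <- s) qfact k.
  elim: s => [|j s [c Hc]]; first by exists (qfact 0); rewrite big_nil mulr1.
  exists (qbin (sumn s + j) j * c); rewrite big_cons /= addnC -qbin_fact Hc; ring.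
have nz s : \prod_(k <- s) qfact k != 0.
  elim: s => [|j s IH]; first by rewrite big_nil oner_eq0.
  by rewrite big_cons mulf_neq0 ?qfact_neq0.
have [c Hc] := exact ks.
rewrite big_cons /= addnC -qbin_fact Hc mulpK ?nz //.
have -> : qbin (sumn ks + k) k * (c * \prod_(j <- ks) qfact j) * qfact k
  = qbin (sumn ks + k) k * c * (qfact k * \prod_(j <- ks) qfact j) by ring.
by rewrite mulpK // mulf_neq0 ?nz ?qfact_neq0.
Qed.

(* [Node f1 f2] is the leftmost root edge, with [f1] below it and [f2] to its right. *)
Inductive forest := Nil | Node of forest & forest.

Fixpoint word f :=
  if f is Node f1 f2 then true :: word f1 ++ false :: word f2 else [::].

Fixpoint nchords f := if f is Node f1 f2 then (nchords f1 + nchords f2).+1 else 0%N.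

(** Against an up step of [lam] the gap stays or drops by one; against a down step it stays or grows
    by one. The weight of an up step depends on a label and is therefore left to [forest_gf]. *)
Definition upW (J : nat -> P) l := J l + (if l is l'.+1 then J l' else 0).
Definition downW (K : nat -> P) r := 'X^r * K r + 'X^(r.+1) * K r.+1.

(* Weighted sum of [K] (final gap) over the codes of [word f] that start at gap [l] and
   have all labels at least [lo].  [h] is the gap after the opening step and [m] the label
   of the chord. *)
Fixpoint forest_gf f lo (K : nat -> P) l : P :=
  if f is Node f1 f2 then
    upW (fun h => \sum_(lo <= m < h.+1) 'X^(h - m) * forest_gf f1 m (downW (forest_gf f2 lo K)) h) l
  else K l.

Lemma eq_upW J1 J2 : J1 =1 J2 -> upW J1 =1 upW J2.
Proof. by move=> E [|l]; rewrite /upW !E. Qed.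

Lemma eq_downW K1 K2 : K1 =1 K2 -> downW K1 =1 downW K2.
Proof. by move=> E r; rewrite /downW !E. Qed.

Lemma eq_forest_gf f lo K1 K2 : K1 =1 K2 -> forest_gf f lo K1 =1 forest_gf f lo K2.
Proof.
elim: f lo K1 K2 => [|f1 IH1 f2 IH2] lo K1 K2 E //=.
apply: eq_upW => h; apply: eq_bigr => m _; congr (_ * _).
by apply: IH1; apply: eq_downW; apply: IH2.
Qed.

Lemma forest_gf_scale f lo c K l : forest_gf f lo (fun i => c * K i) l = c * forest_gf f lo K l.
Proof.
elim: f lo K l => [|f1 IH1 f2 IH2] lo K l //=.
rewrite (@eq_upW _ (fun h => c * \sum_(lo <= m < h.+1)
   'X^(h - m) * forest_gf f1 m (downW (forest_gf f2 lo K)) h)) => [|h].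
  by case: l => [|l]; rewrite /upW mulrDr ?mulr0.
rewrite mulr_sumr; apply: eq_bigr => m _.
rewrite (@eq_forest_gf _ _ _ (fun i => c * downW (forest_gf f2 lo K) i)) => [|r].
  by rewrite IH1; ring.
by rewrite /downW !IH2; ring.
Qed.

(** Raising all gaps and labels by one preserves the differences [h - m] at opening steps and gives
    one more factor q at each closing step. *)
Lemma forest_gf_shift f lo K l :
  forest_gf f lo.+1 K l.+1 = 'X^(nchords f) * forest_gf f lo (fun i => K i.+1) l.
Proof.
elim: f lo K l => [|f1 IH1 f2 IH2] lo K l /=; first by rewrite mul1r.
have H h : \sum_(lo.+1 <= m < h.+2) 'X^(h.+1 - m) * forest_gf f1 m (downW (forest_gf f2 lo.+1 K)) h.+1
  = 'X^((nchords f1 + nchords f2).+1) *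
    \sum_(lo <= m < h.+1) 'X^(h - m) * forest_gf f1 m (downW (forest_gf f2 lo (fun i => K i.+1))) h.
  rewrite big_add1 mulr_sumr /=; apply: eq_bigr => m _; rewrite subSS IH1.
  rewrite (@eq_forest_gf _ _ _ (fun i => 'X^((nchords f2).+1) * downW (forest_gf f2 lo (fun i => K i.+1)) i)).
    by rewrite forest_gf_scale !exprS exprD; ring.
  by move=> r; rewrite /downW !IH2 !exprS; ring.
rewrite /upW H; case: l => [|l]; last by rewrite H mulrDr.
(* A drop from gap 1 to gap 0 leaves no label that is at least [lo.+1], which matches the missing
   second term of [upW] at 0. *)
by rewrite big_geq ?addr0.
Qed.

(* [qsum n K] and [qsum0 n K] are the images of [\prod_(1 <= i <= n) (1 + q^i x)] and of
   [\prod_(0 <= i < n) (1 + q^i x)] under the linear map [x^r |-> K r]. *)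
Fixpoint qsum n (K : nat -> P) : P :=
  if n is n'.+1 then qsum n' K + 'X^n * qsum n' (fun i => K i.+1) else K 0%N.

Fixpoint qsum0 n (K : nat -> P) : P :=
  if n is n'.+1 then qsum0 n' K + 'X^n' * qsum0 n' (fun i => K i.+1) else K 0%N.

Lemma eq_qsum n K1 K2 : K1 =1 K2 -> qsum n K1 = qsum n K2.
Proof.
by elim: n K1 K2 => [|n IH] K1 K2 E /=; [exact: E | congr (_ + _ * _); apply: IH => i; exact: E].
Qed.

Lemma qsumZ n c K : qsum n (fun i => c * K i) = c * qsum n K.
Proof. by elim: n K => [|n IH] K //=; rewrite !IH; ring. Qed.

Lemma eq_qsum0 n K1 K2 : K1 =1 K2 -> qsum0 n K1 = qsum0 n K2.
Proof.
by elim: n K1 K2 => [|n IH] K1 K2 E /=; [exact: E | congr (_ + _ * _); apply: IH => i; exact: E].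
Qed.

Lemma qsum0D n K1 K2 : qsum0 n (fun i => K1 i + K2 i) = qsum0 n K1 + qsum0 n K2.
Proof. by elim: n K1 K2 => [|n IH] K1 K2 //=; rewrite !IH; ring. Qed.

Lemma qsum0Z n c K : qsum0 n (fun i => c * K i) = c * qsum0 n K.
Proof. by elim: n K => [|n IH] K //=; rewrite !IH; ring. Qed.

(** On polynomials, [downW] sends p(x) to (1 + q x) p(q x), which turns the product for n into the
    one for n + 1. *)
Lemma qsum_downW n K : qsum n (downW K) = qsum n.+1 K.
Proof.
elim: n K => [|n IH] K; first by rewrite /= /downW expr0 mul1r.
rewrite -[LHS]/(qsum n (downW K) + 'X^(n.+1) * qsum n (fun i => downW K i.+1)).
rewrite (@eq_qsum n (fun i => downW K i.+1) (fun i => 'X * downW (fun i => K i.+1) i)) => [|i]; last first.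
  by rewrite /downW !exprS /=; ring.
by rewrite qsumZ !IH -[RHS]/(qsum n.+1 K + 'X^(n.+2) * qsum n.+1 (fun i => K i.+1)) !exprS; ring.
Qed.

(** Multiplication by 1 + x supplies the factor of index 0. *)
Lemma qsum_addS n J : qsum n (fun l => J l.+1 + J l) = qsum0 n.+1 J.
Proof.
elim: n J => [|n IH] J; first by rewrite /= expr0 mul1r addrC.
rewrite -[LHS]/(qsum n (fun l => J l.+1 + J l) + 'X^(n.+1) * qsum n (fun l => J l.+2 + J l.+1)).
by rewrite IH (IH (fun i => J i.+1)).
Qed.

(** A new last factor adds q^(n+1) x times the product for n. This has no constant term, so on it
    [upW] acts as multiplication by 1 + 1/x. *)
Lemma qsum_upW n J : qsum n (upW J) = \sum_(i < n.+1) 'X^i * qsum0 i J.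
Proof.
elim: n => [|n IH]; first by rewrite big_ord_recl big_ord0 /= /upW expr0 mul1r.
rewrite big_ord_recr -IH.
rewrite -[LHS]/(qsum n (upW J) + 'X^(n.+1) * qsum n (fun l => J l.+1 + J l)).
by rewrite qsum_addS.
Qed.

(** Substituting q x for x moves the indices 0, ..., n-1 of the factors to 1, ..., n. *)
Lemma qsum0_scale n J : qsum0 n (fun l => 'X^l * J l) = qsum n J.
Proof.
elim: n J => [|n IH] J /=; first by rewrite expr0 mul1r.
rewrite IH (@eq_qsum0 _ _ (fun i => 'X * ('X^i * J i.+1))) => [|i].
  by rewrite qsum0Z IH exprS; ring.
by rewrite exprS; ring.
Qed.

(** The left side drops the constant term and divides by x; each new factor 1 + q^n x then
    contributes q^n times the previous product. *)
Lemma qsum0_shift n J : qsum0 n (fun l => if l is l'.+1 then J l' else 0) = \sum_(i < n) 'X^i * qsum0 i J.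
Proof.
elim: n => [|n IH]; first by rewrite big_ord0.
by rewrite big_ord_recr -IH.
Qed.

(** The constant F of the overview: the q-multinomial at each vertex is a product of q-binomials
    splitting off its edges from left to right. *)
Fixpoint forest_product f : P :=
  if f is Node f1 f2 then
    forest_product f1 * forest_product f2 * qbin (nchords f2 + (nchords f1).+1) (nchords f1).+1
  else 1.

Definition node_gf f (K : nat -> P) h := \sum_(0 <= m < h.+1) 'X^(h - m) * forest_gf f m K h.

(** The label 0 is split off, and the positive labels are lowered by one with [forest_gf_shift]. *)
Lemma node_gf_rec f K : node_gf f K =1 fun l => 'X^l * forest_gf f 0 K l +
  'X^(nchords f) * (if l is l'.+1 then node_gf f (fun i => K i.+1) l' else 0).
Proof.
case=> [|l]; rewrite /node_gf big_nat_recl // ?subn0; first by rewrite big_geq // mulr0.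
congr (_ + _); rewrite mulr_sumr; apply: eq_bigr => m _.
by rewrite subSS forest_gf_shift; ring.
Qed.

(** Induction on [n] for all [K]. By [bV] the new last term reduces to [Hf] and to the sum for [n]
    with [K] shifted; the Pascal rule and the recursion of [qsum] reassemble the result. *)
Lemma qsum0_node_gf f
    (Hf : forall n K, qsum n (forest_gf f 0 K) =
       forest_product f * qbin (n + nchords f) (nchords f) * qsum (n + nchords f) K) n K :
  \sum_(i < n.+1) 'X^i * qsum0 i (node_gf f K) =
  forest_product f * qbin (n + (nchords f).+1) (nchords f).+1 * qsum (n + nchords f) K.
Proof.
set k := nchords f in Hf *.
have bV m J : qsum0 m (node_gf f J) =
    qsum m (forest_gf f 0 J) + 'X^k * \sum_(i < m) 'X^i * qsum0 i (node_gf f (fun i => J i.+1)).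
  rewrite (eq_qsum0 _ (@node_gf_rec f J)) qsum0D qsum0_scale; congr (_ + _).
  by rewrite qsum0Z qsum0_shift.
elim: n K => [|n IHn] K.
  rewrite big_ord_recl big_ord0 bV big_ord0 Hf !add0n !qbinn expr0.
  by ring.
rewrite big_ord_recr bV (IHn K) (IHn (fun i => K i.+1)) Hf.
have -> : qbin (n.+1 + k.+1) k.+1 = qbin (n + k.+1) k.+1 + 'X^(n.+1) * qbin (n + k.+1) k.
  by rewrite addSn /= addnS subSn ?leq_addl // addnK.
rewrite (_ : n.+1 + k = (n + k).+1)%N // addnS.
rewrite -[qsum (n + k).+1 K]/(qsum (n + k) K + 'X^((n + k).+1) * qsum (n + k) (fun i => K i.+1)).
by rewrite !exprS exprD /=; ring.
Qed.

(** With k1 and k2 chords in [f1] and [f2], the opening step together with [f1] takes e_n to a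
    multiple of e_(n+k1), the closing step gives e_(n+k1+1), and [f2] gives e_(n+k1+1+k2). *)
Lemma qsum_forest_gf f n K :
  qsum n (forest_gf f 0 K) = forest_product f * qbin (n + nchords f) (nchords f) * qsum (n + nchords f) K.
Proof.
elim: f n K => [|f1 IH1 f2 IH2] n K; first by rewrite /= addn0 qbin0 !mul1r.
rewrite -[forest_gf _ 0 K]/(upW (node_gf f1 (downW (forest_gf f2 0 K)))) qsum_upW qsum0_node_gf // qsum_downW IH2.
rewrite [forest_product (Node _ _)]/=; set k1 := nchords f1; set k2 := nchords f2.
rewrite (_ : nchords _ = k2 + k1.+1)%N; last by rewrite /= /k2 addnS addnC.
rewrite (_ : (n + k1).+1 + k2 = n + (k2 + k1.+1))%N; last by lia.
(* Both sides are the q-trinomial with lower entries [n], [k1.+1] and [k2]. *)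
suff E : qbin (n + k1.+1) k1.+1 * qbin (n + (k2 + k1.+1)) k2 =
    qbin (k2 + k1.+1) k1.+1 * qbin (n + (k2 + k1.+1)) (k2 + k1.+1).
  have -> A B C : forest_product f1 * A * (forest_product f2 * B * C) =
    forest_product f1 * forest_product f2 * (A * B) * C by move=> *; ring.
  by rewrite E; ring.
have H1 := qbin_fact n k1.+1; have H2 := qbin_fact (n + k1.+1) k2.
have H3 := qbin_fact k2 k1.+1; have H4 := qbin_fact n (k2 + k1.+1).
have N3 : qfact n * qfact k1.+1 * qfact k2 != 0 by rewrite !mulf_neq0 ?qfact_neq0.
apply: (mulIf N3).
rewrite (_ : n + k1.+1 + k2 = n + (k2 + k1.+1))%N in H2; last by lia.
transitivity (qfact (n + (k2 + k1.+1))).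
  by rewrite -H2 -H1; ring.
by rewrite -H4 -H3; ring.
Qed.

(** * Codes and their weighted enumeration *)

(* A code of [lam] lists, for every step of [lam], the corresponding step [c] of [mu] and
   the label [m] of the chord of [lam] containing it.  [upstep] and [downstep] give the
   gap after an up (down) step of [lam].  While a code is read, [h] is the current gap and
   [st] the stack of the labels of the open chords. *)
Definition upstep (c : bool) (h : nat) := if c then h else h.-1.
Definition downstep (c : bool) (h : nat) := if c then h.+1 else h.

(** Chords left open at the end must have label 0; this agrees with [level_ok], which requires depth
    0 at the end for every [k > 0]. *)
Definition final (h : nat) (st : seq nat) := (h == 0%N) && all (eq_op 0%N) st.

Fixpoint valid_code (lam : seq bool) (z : seq (bool * nat)) (h : nat) (st : seq nat) : bool :=
  match lam, z with
  | [::], [::] => final h st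
  | true :: lam', (c, m) :: z' =>
      [&& c || (0 < h)%N, (head 0 st <= m)%N, (m <= upstep c h)%N
        & valid_code lam' z' (upstep c h) (m :: st)]
  | false :: lam', (c, m) :: z' =>
      (m == head 0%N st) && valid_code lam' z' (downstep c h) (behead st)
  | _, _ => false
  end.

Fixpoint code_weight (lam : seq bool) (z : seq (bool * nat)) (h : nat) : nat :=
  match lam, z with
  | true :: lam', (c, m) :: z' => (upstep c h - m + code_weight lam' z' (upstep c h))%N
  | false :: lam', (c, m) :: z' => (downstep c h + code_weight lam' z' (downstep c h))%N
  | _, _ => 0%N
  end.

Fixpoint word_gf (lam : seq bool) (h : nat) (st : seq nat) (K : nat -> seq nat -> P) : P :=
  match lam with
  | [::] => K h st
  | true :: lam' =>
      upW (fun h' => \sum_(head 0%N st <= m < h'.+1)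
                       'X^(h' - m) * word_gf lam' h' (m :: st) K) h
  | false :: lam' => downW (fun h' => word_gf lam' h' (behead st) K) h
  end.

Lemma word_gf_word f lam h st K :
  word_gf (word f ++ lam) h st K = forest_gf f (head 0%N st) (fun r => word_gf lam r st K) h.
Proof.
elim: f lam h st => [|f1 IH1 f2 IH2] lam h st //=.
apply: eq_upW => h'; apply: eq_bigr => m _; congr (_ * _).
rewrite -catA IH1 /=; apply: eq_forest_gf => r; apply: eq_downW => r'.
by rewrite /= IH2.
Qed.

Lemma big_tuple_cons n (S : finType) (Q : pred (seq S)) (G : seq S -> P) :
  \sum_(z : n.+1.-tuple S | Q z) G z =
  \sum_(a : S) \sum_(z : n.-tuple S | Q (a :: z)) G (a :: z).
Proof.
rewrite pair_big_dep (reindex (fun p : S * n.-tuple S => [tuple of p.1 :: p.2])) //=.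
exists (fun z => (thead z, [tuple of behead z])) => [[a z]|z] _.
  by congr pair; apply: val_inj.
by rewrite -tuple_eta.
Qed.

Section Enumeration.
Variable N : nat.

Definition vals (z : seq (bool * 'I_N)) := [seq (x.1, val x.2) | x <- z].

Lemma sum_ord_nat (lo h : nat) (G : nat -> P) : (h < N)%N ->
  \sum_(m < N | (lo <= m <= h)%N) G m = \sum_(lo <= m < h.+1) G m.
Proof.
move=> hN; rewrite (big_geq_mkord lo h.+1).
by rewrite (big_ord_widen_cond N (fun i => (lo <= i)%N) G).
Qed.

(** Labels are bounded by the gap, and the gap grows by at most one per step, so no code is lost by
    taking labels in ['I_N]. *)
Lemma sum_valid_codes lam h st : (h + size lam < N)%N -> all (fun m => m < N)%N st ->
  \sum_(z : (size lam).-tuple (bool * 'I_N) | valid_code lam (vals z) h st)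
     'X^(code_weight lam (vals z) h)
  = word_gf lam h st (fun h st => (final h st)%:R).
Proof.
elim: lam h st => [|c lam IH] h st hN stN.
  rewrite /= big_mkcond (eq_bigr (fun _ => (final h st)%:R)) => [|z _].
    by rewrite sumr_const card_tuple expn0 mulr1n.
  by rewrite tuple0 /=; case: final.
have lstN m : (m < N)%N -> all (fun m => m < N)%N (m :: st) by move=> /= ->.
rewrite -[size (c :: lam)]/(size lam).+1 /= in hN *.
rewrite (big_tuple_cons (size lam) (fun z => valid_code (c :: lam) (vals z) h st)
  (fun z => 'X^(code_weight (c :: lam) (vals z) h))).
rewrite -(pair_bigA _ (fun (d : bool) (m : 'I_N) => \sum_(z : (size lam).-tuple (bool * 'I_N) |
  valid_code (c :: lam) (vals ((d, m) :: z)) h st) 'X^(code_weight (c :: lam) (vals ((d, m) :: z)) h))) /=.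
case: c hN => hN.
  have E d : \sum_(m < N) \sum_(z : (size lam).-tuple (bool * 'I_N) |
       [&& d || (0 < h)%N, (head 0%N st <= m)%N, (m <= upstep d h)%N
         & valid_code lam (vals z) (upstep d h) (val m :: st)])
       'X^(upstep d h - m + code_weight lam (vals z) (upstep d h)) =
     if d || (0 < h)%N then \sum_(head 0%N st <= m < (upstep d h).+1)
       'X^(upstep d h - m) * word_gf lam (upstep d h) (m :: st) (fun h st => (final h st)%:R) else 0 :> P.
    case: ifP => Hd; last by rewrite big1 // => m _; rewrite big_pred0.
    rewrite -sum_ord_nat; last by rewrite /upstep; case: d {Hd}; lia.
    rewrite [RHS]big_mkcond; apply: eq_bigr => m _.
    case: ifP => Hm; last by rewrite big_pred0 // => z /=; rewrite ?andTb andbA Hm.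
    rewrite -IH ?lstN //; last by rewrite /upstep; case: d {Hd Hm}; lia.
    rewrite mulr_sumr; apply: eq_big => [z|z _]; last by rewrite exprD.
    by rewrite ?andTb andbA Hm.
  rewrite big_bool /=; have /= -> := E true; have /= -> := E false.
  by case: h {E hN}.
have stN' : all (fun m => m < N)%N (behead st) by case: (st) stN => //= ? ? /andP[].
have lt0 : (head 0 st < N)%N by case: (st) stN => /= [|? ? /andP[]] //; lia.
have E d : \sum_(m < N) \sum_(z : (size lam).-tuple (bool * 'I_N) |
     (val m == head 0%N st) && valid_code lam (vals z) (downstep d h) (behead st))
     'X^(downstep d h + code_weight lam (vals z) (downstep d h)) =
   'X^(downstep d h) * word_gf lam (downstep d h) (behead st) (fun h st => (final h st)%:R) :> P.
  rewrite (bigD1 (Ordinal lt0)) //= eqxx [X in _ + X]big1 ?addr0 => [|m ne]; last first.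
    by rewrite big_pred0 // => z; apply: contraNF ne => /andP[/eqP Em _]; apply/eqP/val_inj.
  rewrite -IH //; last by rewrite /downstep; case: d; lia.
  by rewrite mulr_sumr; apply: eq_bigr => z _; rewrite exprD.
rewrite big_bool /=; have /= -> := E true; have /= -> := E false.
by rewrite addrC.
Qed.
End Enumeration.

Lemma qsum_final n : qsum n (fun h => (final h [::])%:R) = 1.
Proof.
have e0 m : qsum m (fun=> 0) = 0 by elim: m => //= m ->; rewrite mulr0 addr0.
by elim: n => //= n ->; rewrite e0 mulr0 addr0.
Qed.

(** Starting at gap 0 means applying [qsum 0], and every [qsum] takes the value 1 at the indicator
    of gap 0. *)
Lemma word_gf_forest_product f : word_gf (word f) 0 [::] (fun h st => (final h st)%:R) = forest_product f.
Proof.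
rewrite -[word f]cats0 word_gf_word /= -[LHS]/(qsum 0 (forest_gf f 0 (fun h => (final h [::])%:R))).
by rewrite qsum_forest_gf qsum_final add0n qbinn !mulr1.
Qed.

End GeneratingFunctions.

(** * Codes as height and depth functions *)

(** Since [ht p x] is twice this number minus [x], heights can be compared within [nat]. *)
Definition nup (p : seq bool) (x : nat) := count id (take x p).

Fixpoint heights_ok (lam : seq bool) (z : seq (bool * nat)) (h : nat) : bool :=
  match lam, z with
  | [::], [::] => h == 0
  | true :: lam', (c, m) :: z' => [&& c || (0 < h), m <= upstep c h & heights_ok lam' z' (upstep c h)]
  | false :: lam', (c, m) :: z' => (m <= h) && heights_ok lam' z' (downstep c h)
  | _, _ => false
  end.

(* For fixed [k], the steps with label at least [k] are those inside the tiles of level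
   [k]; along them the depth is the height above the base of the tile.  Equivalently, it
   is the number of open chords with label at least [k]. *)
Definition depth_step (k : nat) (a : bool) (m c : nat) :=
  if k <= m then (if a then c.+1 else c.-1) else 0.

(** Inside a run of labels at least [k] a down step needs positive depth, and a run may stop only at
    depth 0: the runs are Dyck paths. *)
Definition depth_test (k : nat) (a : bool) (m c : nat) :=
  if k <= m then a || (0 < c) else c == 0.

Fixpoint level_ok (k : nat) (lam : seq bool) (ss : seq nat) (c : nat) : bool :=
  match lam, ss with
  | a :: lam', m :: ss' => depth_test k a m c && level_ok k lam' ss' (depth_step k a m c)
  | _, _ => c == 0
  end.

Lemma sorted_count (k : nat) st : sorted geq st ->
  (0 < count (leq k) st) = (0 < k <= head 0 st) || ((k == 0) && (st != [::])).
Proof.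
case: k => [|k].
  by rewrite (eq_count (a2 := xpredT)) ?count_predT //; case: st.
case: st => //= m st; rewrite orbF => Hs.
have [//|lt_mk] := leqP k.+1 m; rewrite add0n lt0n; apply: negbTE; rewrite negbK.
rewrite -leqn0 leqNgt -has_count; apply/negP => /hasP[j jst kj].
have tr : transitive geq by move=> x y w /= H1 H2; apply: leq_trans H2 H1.
by have /allP/(_ j jst) /= := order_path_min tr Hs; rewrite leqNgt (leq_trans lt_mk kj).
Qed.

(** A weakly decreasing stack is known, up to zeros, from its numbers of entries at least [k] for
    [k > 0], so the stack conditions split into one condition per level. Conversely, the tests at
    the levels [head 0 st] and [m] compare [m] with the top of the stack. *)
Lemma valid_codeP lam z h st : sorted geq st -> head 0 st <= h -> size z = size lam ->
  reflect (heights_ok lam z h /\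
           forall k, 0 < k -> level_ok k lam (unzip2 z) (count (leq k) st))
          (valid_code lam z h st).
Proof.
have cpos k st' : 0 < k -> sorted geq st' -> (0 < count (leq k) st') = (k <= head 0 st').
  by move=> k0 Hs; rewrite sorted_count // k0; case: k k0 => // k _; rewrite orbF.
have czero k st' : 0 < k -> sorted geq st' -> (count (leq k) st' == 0) = (head 0 st' < k).
  by move=> k0 Hs; rewrite ltnNge -cpos // lt0n negbK.
elim: lam z h st => [|a lam IH] [|[c m] z] //= h st Hs Hh Hsz.
  apply: (iffP andP) => [[-> st0]|[-> H]]; split=> //.
    by move=> k k0; rewrite czero //; case: (st) st0 => //= m st' /andP[/eqP <-].
  have := H 1%N isT; rewrite czero // => Hst.
  case: st Hs {Hh H} Hst => //= m st Hs Hm.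
  have m0 : m = 0 by lia.
  rewrite m0 eqxx /=; apply/allP => x xst; rewrite m0 in Hs.
  have tr : transitive geq by move=> x' y w /= H1 H2; apply: leq_trans H2 H1.
  by have /allP/(_ x xst) := order_path_min tr Hs; rewrite /= leqn0 eq_sym.
case: Hsz => Hsz; case: a.
  have srt : head 0 st <= m -> sorted geq (m :: st) by case: (st) Hs => //= x s -> ->.
  apply: (iffP and4P) => [[H1 H2 H3 H4]|[/and3P[H1 H3 H4] H]].
    have [H5 H6] := elimT (IH z (upstep c h) (m :: st) (srt H2) H3 Hsz) H4.
    split=> [|k k0]; first exact/and3P.
    have := H6 k k0; rewrite /depth_test /depth_step /=.
    case: (leqP k m) => [km|mk] //=; rewrite add0n.
    have -> : count (leq k) st = 0 by apply/eqP; rewrite czero // (leq_ltn_trans H2).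
    by rewrite eqxx.
  have H2 : head 0 st <= m.
    rewrite leqNgt; apply/negP => mh.
    have /andP[] := H (head 0 st) ltac:(lia).
    by rewrite /depth_test leqNgt mh /= czero ?ltnn //; lia.
  split=> //; apply/(IH z (upstep c h) (m :: st) (srt H2) H3 Hsz); split=> // k k0.
  have := H k k0; rewrite /depth_test /depth_step /=.
  by case: (leqP k m) => [km|mk] //= /andP[/eqP-> ]; rewrite addn0.
have srt : sorted geq (behead st) by case: (st) Hs => //= x s /path_sorted.
have hd : head 0 (behead st) <= downstep c h.
  have : head 0 (behead st) <= head 0 st by case: (st) Hs => [|x [|y s]] //= /andP[].
  by rewrite /downstep; case: (c); lia.
have cnt k : 0 < k -> count (leq k) (behead st) = if k <= head 0 st then (count (leq k) st).-1 else 0.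
  move=> k0; case: (leqP k (head 0 st)) => hk.
    by case: (st) hk => //= x s ->.
  apply/eqP; rewrite czero //.
  apply: leq_ltn_trans hk; by case: (st) Hs => [|x [|y s]] //= /andP[].
apply: (iffP andP) => [[/eqP -> H4]|[/andP[H1 H4] H]].
  have [H5 H6] := elimT (IH z _ _ srt hd Hsz) H4.
  split=> [|k k0]; first by rewrite Hh.
  have := H6 k k0; rewrite cnt // /depth_test /depth_step /= => ->.
  by case: (leqP k (head 0 st)) => [km|mk]; rewrite ?cpos ?km ?czero ?mk.
have E : m = head 0 st.
  apply/eqP; rewrite eqn_leq; apply/andP; split; rewrite leqNgt; apply/negP => mh.
    have /andP[] := H m ltac:(lia).
    by rewrite /depth_test leqnn /= cpos //; lia.
  have /andP[] := H (head 0 st) ltac:(lia).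
  by rewrite /depth_test leqNgt mh /= czero //; lia.
split; first exact/eqP.
apply/(IH z _ _ srt hd Hsz); split=> // k k0.
by have := H k k0; rewrite cnt // /depth_step -E => /andP[_].
Qed.

Fixpoint depth (lam : seq bool) (ss : seq nat) (k c x : nat) : nat :=
  if x is x'.+1 then depth_step k (nth false lam x') (nth 0 ss x') (depth lam ss k c x') else c.

Lemma depth_cons a lam m ss k c x :
  depth (a :: lam) (m :: ss) k c x.+1 = depth lam ss k (depth_step k a m c) x.
Proof. by elim: x => //= x ->. Qed.

Lemma level_okP k lam ss c : size ss = size lam ->
  reflect ((forall i, i < size lam ->
              depth_test k (nth false lam i) (nth 0 ss i) (depth lam ss k c i)) /\
           depth lam ss k c (size lam) = 0)
          (level_ok k lam ss c).
Proof.
elim: lam ss c => [|a lam IH] [|m ss] c //= Hsz.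
  by apply: (iffP eqP) => [->|[]].
case: Hsz => Hsz.
apply: (iffP andP) => [[H1 /IH[] // H2 H3]|[H1 H2]].
  split=> [[|i] // Hi|]; first by rewrite depth_cons; apply: H2.
  by rewrite -[LHS]/(depth (a :: lam) (m :: ss) k c (size lam).+1) depth_cons.
split; first exact: (H1 0 isT).
apply/IH => //; split=> [i Hi|]; last by rewrite -depth_cons.
by rewrite -depth_cons; apply: (H1 i.+1).
Qed.

Lemma nupS p x : x < size p -> nup p x.+1 = nup p x + nth false p x.
Proof. by move=> H; rewrite /nup (take_nth false H) -cats1 count_cat /= addn0. Qed.

Lemma nup0 p : nup p 0 = 0. Proof. by rewrite /nup take0. Qed.

Lemma nup_cons a p x : nup (a :: p) x.+1 = a + nup p x.
Proof. by []. Qed.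

Definition gap_from lam mu h x := h + nup mu x - nup lam x.

Lemma heights_okP lam z h : size z = size lam ->
  reflect [/\ forall x, x <= size lam -> nup lam x <= h + nup (unzip1 z) x,
              h + nup (unzip1 z) (size lam) = nup lam (size lam) &
              forall i, i < size lam -> nth 0 (unzip2 z) i <= gap_from lam (unzip1 z) h i /\
                                        nth 0 (unzip2 z) i <= gap_from lam (unzip1 z) h i.+1]
          (heights_ok lam z h).
Proof.
elim: lam z h => [|a lam IH] [|[c m] z] //= h Hsz.
  apply: (iffP eqP) => [->|[_]]; last by rewrite !nup0 addn0.
  by split=> // x; rewrite leqn0 => /eqP->; rewrite !nup0.
case: Hsz => Hsz.
pose h' := if a then upstep c h else downstep c h.
have Eh : c || (0 < h) || ~~ a -> h' + a = h + c.
  by rewrite /h' /upstep /downstep; case: (a); case: (c); lia.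
(* Up steps never raise the gap and down steps never lower it, so in both cases [m] is bounded by
   the gap at both ends of the step. *)
have -> : (if a then [&& c || (0 < h), m <= upstep c h & heights_ok lam z (upstep c h)]
          else (m <= h) && heights_ok lam z (downstep c h)) =
    [&& c || (0 < h) || ~~ a, m <= h, m <= h' & heights_ok lam z h'].
  rewrite /h' /upstep /downstep; case: (a); rewrite ?orbF ?orbT /=; case: (c).
  - by rewrite /= andbA andbb.
  - by case: (heights_ok _ _ _); rewrite ?andbF ?andbT //; lia.
  - by case: (heights_ok _ _ _); rewrite ?andbF ?andbT //; lia.
  - by rewrite /= andbA andbb.
apply: (iffP and4P) => [[H1 H2 H3 /IH[] // H4 H5 H6]|[H1 H2 H3]].
  have E := Eh H1; split.
  - by move=> [|x] Hx; rewrite ?nup0 // !nup_cons; have := H4 x Hx; lia.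
  - by rewrite !nup_cons; lia.
  move=> [|i] Hi /=; rewrite /gap_from !nup_cons ?nup0.
    by rewrite addn0 subn0 H2; split=> //; lia.
  by have := H6 i Hi; rewrite /gap_from; lia.
have H0 := H1 1 isT; rewrite !nup_cons !nup0 !addn0 in H0.
have H4 : c || (0 < h) || ~~ a by case: (a) (c) H0 => [] [] //=; lia.
have E := Eh H4.
have := H3 0 isT; rewrite /gap_from !nup_cons !nup0 !addn0 /= subn0 => -[H5 H6].
split=> //; first by lia.
apply/IH => //; split.
- by move=> x Hx; have := H1 x.+1 Hx; rewrite !nup_cons; lia.
- by move: H2; rewrite !nup_cons; lia.
by move=> i Hi; have := H3 i.+1 Hi; rewrite /gap_from !nup_cons /=; lia.
Qed.

(** The weight subtracts a label once, at the opening step, whereas the code lists it at both steps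
    of the chord. Chords already open in [st] are listed only when they close. *)
Lemma code_weightP lam z h st : valid_code lam z h st ->
  (code_weight lam z h).*2 + sumn (unzip2 z) =
  (\sum_(i < size lam) gap_from lam (unzip1 z) h i.+1).*2 + sumn st.
Proof.
elim: lam z h st => [|a lam IH] [|[c m] z] //= h st.
  move=> /andP[_ Hst]; rewrite big_ord0 add0n.
  by elim: st Hst => //= x st IHs /andP[/eqP<- /IHs].
  by case: a.
have E h' : h' + a = h + c -> \sum_(i < (size lam).+1) gap_from (a :: lam) (c :: unzip1 z) h i.+1 =
    h' + \sum_(i < size lam) gap_from lam (unzip1 z) h' i.+1.
  move=> Eh; rewrite big_ord_recl /gap_from !nup_cons !nup0 !addn0; congr (_ + _); first by lia.
  by apply: eq_bigr => i _; rewrite !nup_cons lift0; lia.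
case: a E => E.
  move=> /and4P[H1 H2 H3 /IH H4]; rewrite (E (upstep c h)); last first.
    by rewrite /upstep; case: (c) H1 => //=; lia.
  by rewrite [sumn (m :: st)]/= in H4; lia.
move=> /andP[/eqP-> /IH H4]; rewrite (E (downstep c h)); last first.
  by rewrite /downstep; case: (c) => //=; lia.
have -> : sumn st = head 0 st + sumn (behead st) by case: (st).
lia.
Qed.

(** * Tilings and their codes *)

Lemma htE p x : x <= size p -> ht p x = (Posz (nup p x).*2 - Posz x)%R.
Proof.
move=> H; rewrite /ht /nup; have := count_predC id (take x p).
rewrite size_takel // (eq_count (a1 := predC id) (a2 := negb)) // => E.
by lia.
Qed.

Lemma dyckP p : reflect ((forall x, x <= size p -> x <= (nup p x).*2) /\
    (nup p (size p)).*2 = size p) (dyck p).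
Proof.
apply: (iffP andP) => [[/allP H /eqP]|[H E]].
  rewrite htE // => E; split=> [x Hx|]; last by lia.
  have := H x; rewrite mem_iota htE // => /(_ ltac:(lia)) /=; lia.
split; last by rewrite htE //; apply/eqP; lia.
by apply/allP => x; rewrite mem_iota => Hx; rewrite htE; [have := H x|]; lia.
Qed.

Lemma nup_mono p x y : x <= y -> nup p x <= nup p y.
Proof.
move=> Hxy; rewrite /nup -(subnKC Hxy) -[in take (_ + _) _](cat_take_drop x p).
elim: p x {y Hxy} (y - x) => [|a p IH] [|x] d //=; rewrite ?take0 //.
by rewrite leq_add2l; apply: IH.
Qed.

Lemma nup_le p x : nup p x <= x.
Proof. by apply: leq_trans (count_size _ _) _; rewrite size_take_min geq_minl. Qed.

Lemma aboveP n lam mu : size lam = n.*2 -> size mu = n.*2 ->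
  reflect (forall x, x <= n.*2 -> nup lam x <= nup mu x) (above n lam mu).
Proof.
move=> Hl Hm; apply: (iffP allP) => H x => [Hx|].
  by have := H x; rewrite mem_iota !htE ?Hl ?Hm // => /(_ ltac:(lia)); lia.
by rewrite mem_iota => Hx; rewrite !htE ?Hl ?Hm; try lia; have := H x; lia.
Qed.

Section Boxes.
Variables (n : nat) (lam mu : seq bool).
Hypotheses (Hlam : size lam = n.*2) (Dlam : dyck lam).

Local Notation U := (nup lam).

Lemma nup_lam_ge x : x <= n.*2 -> x <= (U x).*2.
Proof. by have [H _] := dyckP _ Dlam; rewrite -Hlam; apply: H. Qed.

(* [box_at x k] is the [k]-th box above [lam] in column [x], counted from [k = 1]; when its
   second coordinate exceeds [n.*2], [inord] returns [0], which is in no skew shape. *)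
Definition box_at x k : box n := (inord x, inord ((U x + k).*2 - x.+1)).
Definition level (c : box n) := (c.1 + c.2).+1./2 - U c.1.

Lemma box_le (c : box n) : c.1 <= n.*2. Proof. by rewrite -ltnS. Qed.

Lemma box_at1 x k : x <= n.*2 -> (box_at x k).1 = x :> nat.
Proof. by move=> Hx; rewrite /box_at /= inordK. Qed.

Hypotheses (Hmu : size mu = n.*2) (Dmu : dyck mu) (Hab : above n lam mu).

Definition gap x := nup mu x - U x.

Lemma nup_lam_le x : x <= n.*2 -> U x <= nup mu x.
Proof. exact: (aboveP Hlam Hmu _). Qed.

Lemma nup_mu_le x : x <= n.*2 -> nup mu x <= n.
Proof.
move=> Hx; have [_ E] := dyckP _ Dmu; rewrite Hmu in E.
have := nup_mono mu Hx; lia.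
Qed.

Lemma gap_le x : x <= n.*2 -> gap x <= n.
Proof. by move=> Hx; have := nup_mu_le Hx; rewrite /gap; lia. Qed.

Lemma gap_end : gap n.*2 = 0.
Proof. by have := nup_lam_ge (leqnn _); have := nup_mu_le (leqnn _); rewrite /gap; lia. Qed.

(** Below [mu] the two bounds in [inY] that do not mention the path hold automatically, because
    [nup mu x] is at most [x] and at most [n]. *)
Lemma mem_skew (c : box n) : (c \in Defs.skew n lam mu) = odd (c.1 + c.2) && (0 < level c <= gap c.1).
Proof.
have Hx := box_le c.
rewrite inE /inY !htE ?Hlam ?Hmu // /level /gap.
case Ho : (odd _) => //=.
have := nup_lam_le Hx; have := nup_mu_le Hx; have := nup_le mu c.1; have := nup_lam_ge Hx.
move: Ho Hx; move: (nat_of_ord c.1) (nat_of_ord c.2) => x y; lia.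
Qed.

Lemma box_at_skew x k : x <= n.*2 -> 0 < k -> (box_at x k \in Defs.skew n lam mu) = (k <= gap x).
Proof.
move=> Hx Hk; rewrite mem_skew /level box_at1 // /box_at /= /inord val_insubd /gap.
have := nup_lam_le Hx; have := nup_mu_le Hx; have := nup_le mu x; have := nup_lam_ge Hx.
case: ifP => Hc; first by lia.
(* Here the second coordinate overflows to 0: the box has level 0, and [k] exceeds the gap. *)
rewrite [X in x + X]/= addn0 uphalf_half; lia.
Qed.

Lemma box_at2 x k : x <= n.*2 -> 0 < k <= gap x -> ((box_at x k).2 + x.+1 = (U x + k).*2)%N.
Proof.
move=> Hx Hk; rewrite /gap in Hk; rewrite /box_at /= inordK; have := nup_lam_le Hx; have := nup_mu_le Hx;
  have := nup_le mu x; have := nup_lam_ge Hx; lia.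
Qed.

Lemma level_box_at x k : x <= n.*2 -> 0 < k <= gap x -> level (box_at x k) = k.
Proof. move=> Hx Hk; have := box_at2 Hx Hk; rewrite /level box_at1 //; lia. Qed.

Lemma skew_level (c : box n) : c \in Defs.skew n lam mu -> 0 < level c <= gap c.1.
Proof. by rewrite mem_skew => /andP[]. Qed.

Lemma skew2 (c : box n) : c \in Defs.skew n lam mu -> (c.2 + c.1.+1 = (U c.1 + level c).*2)%N.
Proof. rewrite mem_skew /level; lia. Qed.

Lemma skew_box_at (c : box n) : c \in Defs.skew n lam mu -> c = box_at c.1 (level c).
Proof.
move=> Hc; have Hx := box_le c; have := skew2 Hc; have := box_at2 Hx (skew_level Hc).
move=> E1 E2; rewrite [LHS]surjective_pairing [RHS]surjective_pairing.
congr pair; apply: val_inj => /=; first by rewrite inordK.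
by move: E1 E2 => /=; lia.
Qed.

Lemma skew_inj (c c' : box n) : c \in Defs.skew n lam mu -> c' \in Defs.skew n lam mu ->
  c.1 = c'.1 :> nat -> level c = level c' -> c = c'.
Proof. by move=> H1 H2 E1 E2; rewrite (skew_box_at H1) E1 E2 -skew_box_at. Qed.

(* [t] is the segment of [lam] over the columns [a, ..., a + m], raised to level [k]; the last
   two clauses say that this segment is a Dyck path. *)
Definition shape (t : {set box n}) (a m k : nat) : Prop :=
  [/\ a + m <= n.*2, t = [set c in Defs.skew n lam mu | (level c == k) && (a <= c.1 <= a + m)],
      forall i, i <= m -> 0 < k <= gap (a + i),
      forall i, i <= m -> i + (U a).*2 <= (U (a + i)).*2 &
      m + (U a).*2 = (U (a + m)).*2].

Lemma mem_shape t a m k x k' : shape t a m k -> x <= n.*2 -> 0 < k' ->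
  (box_at x k' \in t) = (k' == k) && (a <= x <= a + m).
Proof.
move=> [H1 -> H2 _ _] Hx Hk; rewrite inE box_at_skew //.
apply/idP/idP => [/and3P[H3]|].
  have Hk' : 0 < k' <= gap x by rewrite Hk.
  by rewrite level_box_at // box_at1 // => -> ->.
move=> /andP[/eqP -> H4].
have H5 : 0 < k <= gap x by have := H2 (x - a); rewrite subnKC; [apply; lia | lia].
by rewrite level_box_at // box_at1 // H4 eqxx; case/andP: H5 => _ ->.
Qed.

Lemma shape_tile t a m k : shape t a m k -> isDyckTile t.
Proof.
move=> Hs; have [H1 Et H2 H3 H4] := Hs.
have Ha : a < n.*2.+1 by lia.
have Hm : m < n.*2.+1 by lia.
have Hk := H2 0 isT; rewrite addn0 in Hk.
have Hal : a <= n.*2 by lia.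
have sw : size (take m (drop a lam)) = m by rewrite size_takel // size_drop Hlam; lia.
have uw i : i <= m -> nup (take m (drop a lam)) i = U (a + i) - U a.
  by move=> Hi; rewrite /nup take_takel // takeD count_cat addKn.
have mono i : U a <= U (a + i) by apply: nup_mono; lia.
(* At constant level the centers run parallel to [lam], so the Dyck word of the tile is the segment
   of [lam] itself. *)
apply/existsP; exists (Ordinal Ha); apply/existsP; exists (box_at a k).2.
apply/existsP; exists (Ordinal Hm); apply/existsP; exists (@Tuple (Ordinal Hm) bool _ (introT eqP sw)).
rewrite -[tval _]/(take m (drop a lam)) -[nat_of_ord (Ordinal Ha)]/a.
have E2 := box_at2 Hal Hk.
have cen i : i <= m -> (Posz (box_at a k).2 + ht (take m (drop a lam)) i)%R = Posz (box_at (a + i) k).2.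
  move=> Hi; rewrite htE ?sw // uw //.
  have := box_at2 (_ : a + i <= n.*2) (H2 i Hi); have := H3 i Hi; have := mono i; lia.
apply/and3P; split.
- apply/dyckP; rewrite sw; split=> [x Hx|]; rewrite uw //; have := mono m; [have := H3 x Hx; have := mono x|]; lia.
- apply/allP => _ /mapP[c Hc ->]; rewrite mem_enum in Hc.
  apply/mapP; exists (c.1 - a).
    by rewrite mem_iota sw; move: Hc; rewrite Et inE; lia.
  have Hc' := Hc; rewrite Et inE in Hc'.
  case/and3P: Hc' => Hc1 /eqP Hc2 Hc3.
  rewrite cen; last by lia.
  have -> : (a + (c.1 - a)%N)%R = c.1 :> nat by rewrite -[LHS]/(a + (c.1 - a))%N; lia.
  rewrite /coords; congr pair; rewrite subnKC; last by lia.
  by rewrite {1}(skew_box_at Hc1) Hc2.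
apply/allP => _ /mapP[i Hi ->]; rewrite mem_iota sw in Hi.
rewrite cen; last by lia.
apply/mapP; exists (box_at (a + i) k).
  by rewrite mem_enum (mem_shape Hs) ?eqxx //; lia.
by rewrite /coords box_at1 //; lia.
Qed.

(** The centers of a tile of constant level differ in height from [lam] by a constant, so the Dyck
    word of the tile must be a segment of [lam]. *)
Lemma tile_shape t k : isDyckTile t -> t \subset Defs.skew n lam mu ->
  (forall c, c \in t -> level c = k) -> exists a m, shape t a m k.
Proof.
case/existsP=> a /existsP[b /existsP[m /existsP[w /and3P[Dw /allP H1 /allP H2]]]].
move=> /subsetP sub Hlev.
have sw : size w = m by rewrite size_tuple.
have cen i : i <= m -> exists2 c : box n, c \in t & c.1 = a + i :> nat /\
    (c.2 + i = b + (nup w i).*2).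
  move=> Hi; have := H2 ((a + i)%N, (Posz b + ht w i)%R).
  case/(_ _)/mapP; first by apply: map_f; rewrite mem_iota sw.
  move=> c; rewrite mem_enum => Hc [E1 E2]; exists c => //; split; first by rewrite -E1.
  move: E2; rewrite htE ?sw //; move: (nup w i) (nat_of_ord b) (nat_of_ord c.2) => u v y; lia.
have [Hw1 Hw2] := dyckP _ Dw; rewrite sw in Hw1 Hw2.
exists a, m; have Hr i : i <= m -> a + i <= n.*2.
  by move=> /cen[c _ [<- _]]; apply: box_le.
have Hu i : i <= m -> b + (nup w i).*2 + a.+1 = (U (a + i) + k).*2 /\ 0 < k <= gap (a + i).
  move=> /cen[c Hc [E1 E2]]; have := skew2 (sub _ Hc); have := skew_level (sub _ Hc).
  by rewrite Hlev // E1; lia.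
have [Hu0 _] := Hu 0 isT; rewrite nup0 !addn0 in Hu0.
split.
- exact: Hr.
- apply/setP => c; rewrite inE; apply/idP/and3P => [Hc|[Hc1 /eqP Hc2 Hc3]].
    split; [exact: sub | by rewrite Hlev |].
    have /H1/mapP[i] : coords c \in [seq coords c | c in t] by apply: map_f; rewrite mem_enum.
    rewrite mem_iota sw => Hi [Ec _]; have {}Ec : c.1 = (a + i)%N :> nat := Ec; lia.
  have [c' Hc' [E1 E2]] := cen (c.1 - a) ltac:(lia).
  rewrite (_ : c = c') //; apply: skew_inj => //; [exact: sub | | by rewrite Hc2 Hlev].
  by rewrite E1 subnKC //; case/andP: Hc3.
- by move=> i /Hu[].
- move=> i Hi; have [E _] := Hu i Hi; have := Hw1 i Hi; move: E Hu0.
  move: (nup w i) (U (a + i)) (U a) (nat_of_ord a) (nat_of_ord b) => *; lia.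
have [E _] := Hu m (leqnn _); move: E Hu0 Hw2.
move: (nup w m) (U (a + m)) (U a) (nat_of_ord a) (nat_of_ord b) => *; lia.
Qed.

(* [label D i] is the number of levels at which a single tile covers both ends of step [i]. *)
Definition linked (D : {set {set box n}}) i k := box_at i.+1 k \in pblock D (box_at i k).
Definition label D i := \sum_(k < n) linked D i k.+1.
Definition labels_of D := mkseq (label D) n.*2.

(** Serves to read a bound [k <= label D i] off level [k] alone. The induction removes the smallest
    element and shifts the predicate. *)
Lemma downclosed_sum (Q : pred nat) N :
  (forall k, 0 < k -> Q k.+1 -> Q k) -> (forall k, Q k -> k <= N) ->
  forall k, 0 < k -> (k <= \sum_(j < N) Q j.+1) = Q k.
Proof.
elim: N Q => [|N IH] Q Hd Hb [|k] // _.
  by rewrite big_ord0; case E : (Q _) => //; have := Hb _ E.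
rewrite big_ord_recl /= -[Q 1]/(Q 0.+1).
have Hd1 j : Q j.+1 -> Q 1 by elim: j => // j IHj Hj; apply: IHj; apply: Hd.
have IH1 := IH (fun j => (0 < j) && Q j.+1) _ _.
case E1 : (Q 1); last first.
  rewrite big1 => [|i _]; first by case Ek : (Q k.+1) => //; rewrite (Hd1 k Ek) in E1.
  by apply/eqP; rewrite eqb0; apply/negP => /Hd1; rewrite E1.
case: k => [|k]; first by rewrite E1; lia.
rewrite add1n ltnS -[RHS]/((0 < k.+1) && Q k.+2) -IH1 //.
- by move=> j j0 /andP[_ Hj]; rewrite j0 Hd.
by move=> j /andP[_ /Hb].
Qed.

Lemma skew_sub_tile D t : dyck_tiling lam mu D -> t \in D -> t \subset Defs.skew n lam mu.
Proof.
move=> /andP[/and3P[/eqP <- _ _] _] HtD; apply/subsetP => c Hc.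
by apply/bigcupP; exists t.
Qed.

(** * From a tiling to its labels *)

Section Tiling.
Variable D : {set {set box n}}.
Hypotheses (HD : dyck_tiling lam mu D) (CD : cover_inclusive lam D).

(** Induction on the level of one box: a tile whose translate lies below [lam] has level 1
    everywhere, and any other tile moves down into a tile one level lower. *)
Lemma tile_level_const N t c c1 c2 : t \in D -> c \in t -> level c <= N ->
  c1 \in t -> c2 \in t -> level c1 = level c2.
Proof.
elim: N t c c1 c2 => [|N IH] t c c1 c2 HtD Hc Hl H1 H2.
  by have := skew_level (subsetP (skew_sub_tile HD HtD) _ Hc); lia.
have sk x : x \in t -> x \in Defs.skew n lam mu by apply: (subsetP (skew_sub_tile HD HtD)).
have /forall_inP/(_ t HtD)/orP[/forall_inP Hb|/exists_inP[t' Ht'D /forall_inP Ht']] := CD.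
  have E x : x \in t -> level x = 1%N.
    move=> Hx; have := Hb x Hx; rewrite htE ?Hlam ?box_le //.
    have := skew2 (sk x Hx); have := skew_level (sk x Hx).
    move: (U x.1) (nat_of_ord x.1) (nat_of_ord x.2) (level x) => u a b l; clear; lia.
  by rewrite !E.
have E x : x \in t -> exists2 x', x' \in t' & level x = (level x').+1.
  move=> Hx; have /exists_inP[x' Hx' /andP[/eqP E1 /eqP E2]] := Ht' x Hx.
  exists x' => //; have := skew2 (sk x Hx).
  have Hs' := subsetP (skew_sub_tile HD Ht'D) _ Hx'.
  have := skew2 Hs'; rewrite E1 -E2.
  move: (U x.1) (nat_of_ord x.1) (nat_of_ord x'.2) (level x) (level x') => u a b l l'; clear; lia.
have [c' Hc' Ec] := E c Hc; have [c1' Hc1' ->] := E c1 H1; have [c2' Hc2' ->] := E c2 H2.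
by rewrite (IH t' c' c1' c2') // -ltnS -Ec.
Qed.

Lemma tiling_shape t : t \in D -> exists a m k, shape t a m k.
Proof.
move=> HtD; have sub := skew_sub_tile HD HtD.
have [/and3P[_ _ D0] /forall_inP Htile] := andP HD.
have [c Hc] : exists c, c \in t by apply/set0Pn; apply: contraNneq D0 => <-.
have [|a [m Hs]] := @tile_shape t (level c) (Htile t HtD) sub; last by exists a, m, (level c).
by move=> c' Hc'; apply: (@tile_level_const (level c) t c).
Qed.

Lemma linkedP i k : reflect (exists t, [/\ t \in D, box_at i k \in t & box_at i.+1 k \in t]) (linked D i k).
Proof.
have /andP[/and3P[/eqP cov triv _] _] := HD.
apply: (iffP idP) => [|[t [HtD H1 H2]]]; last by rewrite /linked (def_pblock triv HtD H1).
rewrite /linked {1}/pblock; case: pickP => [t /andP[HtD H1] H2|_]; last by rewrite inE.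
by exists t.
Qed.

Lemma tile_sub t c : t \in D -> c \in t -> c \in Defs.skew n lam mu.
Proof. by move=> HtD; apply: (subsetP (skew_sub_tile HD HtD)). Qed.

Lemma tile_eq t t' c : t \in D -> t' \in D -> c \in t -> c \in t' -> t = t'.
Proof.
have /andP[/and3P[_ triv _] _] := HD.
by move=> H1 H2 H3 H4; rewrite -(def_pblock triv H1 H3) (def_pblock triv H2 H4).
Qed.

Lemma tile_of x k : x <= n.*2 -> 0 < k <= gap x -> exists2 t, t \in D & box_at x k \in t.
Proof.
move=> Hx /andP[k0 kh]; have /andP[/and3P[/eqP cov _ _] _] := HD.
have : box_at x k \in cover D by rewrite cov box_at_skew.
by case/bigcupP=> t; exists t.
Qed.

Lemma linked_gap i k : i < n.*2 -> 0 < k -> linked D i k -> k <= gap i /\ k <= gap i.+1.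
Proof.
move=> Hi k0 /linkedP[t [HtD /(tile_sub HtD) H1 /(tile_sub HtD) H2]].
by move: H1 H2; rewrite !box_at_skew // ltnW.
Qed.

(** The tile joining the two boxes at level [k.+1] is too high to have its translate below [lam], so
    its translate lies in one tile, which joins the boxes at level [k]. *)
Lemma linked_mono i k : i < n.*2 -> 0 < k -> linked D i k.+1 -> linked D i k.
Proof.
move=> Hi k0 Hl; have [h1 h2] := linked_gap Hi (ltn0Sn k) Hl.
have {Hl}/linkedP[t [HtD H1 H2]] := Hl.
have /forall_inP/(_ t HtD)/orP[/forall_inP Hb|/exists_inP[t' Ht'D /forall_inP Ht']] := CD.
  have := Hb _ H1; rewrite htE ?Hlam ?box_le // (@box_at1 i k.+1 (ltnW Hi)).
  have := @box_at2 i k.+1 (ltnW Hi) h1.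
  move: (U i) (nat_of_ord (box_at i k.+1).2) k0 => u b; clear => *; exfalso; lia.
have E x : x <= n.*2 -> k < gap x -> box_at x k.+1 \in t -> box_at x k \in t'.
  move=> Hx hx Ht; have /exists_inP[c Hc /andP[/eqP E1 /eqP E2]] := Ht' _ Ht.
  rewrite box_at1 // in E1; suff -> : box_at x k = c by [].
  have Hs := tile_sub Ht'D Hc.
  apply: skew_inj => //; rewrite ?box_at1 ?level_box_at ?box_at_skew // ?k0 ?(ltnW hx) //.
  have := skew2 Hs; have := @box_at2 x k.+1 Hx hx; rewrite -E2 E1.
  by move: (U x) (nat_of_ord c.2) (level c) => u b l; clear; lia.
by apply/linkedP; exists t'; split=> //; apply: E => //; apply: ltnW.
Qed.

Lemma label_linked i k : i < n.*2 -> 0 < k -> (k <= label D i) = linked D i k.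
Proof.
move=> Hi k0; have := @downclosed_sum (fun k => (0 < k) && linked D i k) n.
move=> /(_ _ _ k k0); rewrite k0 /= => <- //.
  by move=> j j0 /(linked_mono Hi j0) ->; rewrite j0.
by move=> j /andP[j0 /(linked_gap Hi j0)[Hj _]]; apply: leq_trans Hj (gap_le (ltnW Hi)).
Qed.

Lemma nth_labels_of i : i < n.*2 -> nth 0 (labels_of D) i = label D i.
Proof. by move=> Hi; rewrite nth_mkseq. Qed.

(** Tiles of the same level are disjoint, so a link cannot leave a tile through its last column. *)
Lemma linked_shape t a m k i k' : t \in D -> shape t a m k -> i < n.*2 -> 0 < k' ->
  a <= i <= a + m -> k' = k -> linked D i k' = (i < a + m).
Proof.
move=> HtD Hs Hi k0 Hai Ek; apply/linkedP/idP => [[t' [Ht'D H1 H2]]|Him].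
  have E : t' = t by apply: tile_eq H1 _ => //; rewrite (mem_shape Hs) // ?(ltnW Hi) // Ek eqxx Hai.
  by move: H2; rewrite E (mem_shape Hs) // => /and3P[].
exists t; rewrite !(mem_shape Hs) // ?(ltnW Hi) // Ek eqxx Hai Him.
by split=> //; case/andP: Hai => /leqW ->.
Qed.

Lemma linked_shape_first t a m k i : t \in D -> shape t a m k -> i.+1 = a -> 0 < k ->
  linked D i k = false.
Proof.
move=> HtD Hs Ea k0; have [Ham _ _ _ _] := Hs.
apply/linkedP => -[t' [Ht'D H1 H2]].
have E : t' = t by apply: tile_eq H2 _ => //; rewrite (mem_shape Hs) // ?eqxx; lia.
by move: H1; rewrite E (mem_shape Hs) //; lia.
Qed.

(** No link enters the first column [a] of a tile, so the depth is 0 there; it then follows [lam].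
    The equation says that the depth is [ht lam x - ht lam a]. *)
Lemma depth_tiling k x : 0 < k -> x <= n.*2 ->
  (gap x < k -> depth lam (labels_of D) k 0 x = 0) /\
  forall t a m, t \in D -> shape t a m k -> a <= x <= a + m ->
    depth lam (labels_of D) k 0 x + x + (U a).*2 = (U x).*2 + a.
Proof.
move=> k0; elim: x => [|x IH] Hx.
  split=> // t a m _ _; rewrite leqn0 => /andP[/eqP -> _].
  by rewrite nup0 addn0.
have [IH1 IH2] := IH (ltnW Hx).
rewrite -[depth _ _ _ _ x.+1]/(depth_step k (nth false lam x) (nth 0 (labels_of D) x)
  (depth lam (labels_of D) k 0 x)).
rewrite /depth_step nth_labels_of // label_linked //.
split=> [hk|t a m HtD Hs Hax].
  case: ifP => // /(linked_gap Hx k0)[_]; lia.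
have [Ham _ Hkh Hd He] := Hs.
have [ax|xa] := leqP a x; last first.
  have Ea : x.+1 = a by lia.
  by rewrite (linked_shape_first HtD Hs Ea k0) Ea; lia.
rewrite (linked_shape HtD Hs) //; last by lia.
rewrite (_ : x < a + m); last by lia.
have := IH2 t a m HtD Hs; rewrite nupS ?Hlam //.
have := Hd (x.+1 - a); rewrite subnKC; last by lia.
rewrite nupS ?Hlam //.
move: (depth _ _ _ _ _) => e.
by case: (nth _ _ _) => /=; lia.
Qed.

(** The tests at level [k] hold because each tile lies over a Dyck segment of [lam], whose height
    above its base is the depth. *)
Lemma tiling_valid_code mus : size mus = n.*2 -> unzip1 mus = mu ->
  unzip2 mus = labels_of D -> valid_code lam mus 0 [::].
Proof.
move=> Hz E1 E2; apply/valid_codeP => //; first by rewrite Hz Hlam.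
split.
  apply/heights_okP; first by rewrite Hz Hlam.
  rewrite E1 E2 Hlam; split=> [x|//|i Hi]; first exact: nup_lam_le.
    by have := gap_end; rewrite /gap add0n; have := nup_lam_le (leqnn n.*2); lia.
  rewrite nth_labels_of // -[gap_from _ _ _ _]/(gap i) -[gap_from _ _ _ i.+1]/(gap i.+1).
  have [->|s0] := posnP (label D i); first by [].
  by apply: linked_gap; rewrite // -label_linked.
move=> k k0; rewrite E2 /=; apply/level_okP; first by rewrite size_mkseq Hlam.
rewrite Hlam; split=> [i Hi|].
  have [H1 H2] := depth_tiling k0 (ltnW Hi).
  rewrite /depth_test nth_labels_of // label_linked //.
  have [kh|hk] := leqP k (gap i); last first.
    rewrite H1 //; case: ifP => // /(linked_gap Hi k0)[]; lia.
  have [|t HtD Ht] := @tile_of i k (ltnW Hi); first by rewrite k0.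
  have [a [m [k' Hs]]] := tiling_shape HtD.
  move: Ht; rewrite (mem_shape Hs) ?(ltnW Hi) // => /andP[/eqP Ek Hai].
  rewrite -Ek in Hs.
  have := H2 t a m HtD Hs Hai; rewrite (linked_shape HtD Hs) // => Ed.
  have [Ham _ _ Hd He] := Hs.
  case: ifP => Him.
    have := Hd (i.+1 - a); rewrite subnKC; last by lia.
    by rewrite nupS ?Hlam //; case: (nth _ _ _) => //=; lia.
  by have Ei : i = a + m by [lia]; rewrite Ei in Ed *; lia.
by have [H1 _] := depth_tiling k0 (leqnn n.*2); apply: H1; rewrite gap_end.
Qed.

End Tiling.

(** * From labels back to a tiling *)

Section Untiling.
Variable ss : seq nat.
Hypothesis Sh : forall i, i < n.*2 -> nth 0 ss i <= gap i /\ nth 0 ss i <= gap i.+1.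
Hypothesis Slev : forall k, 0 < k ->
  (forall i, i < n.*2 -> depth_test k (nth false lam i) (nth 0 ss i) (depth lam ss k 0 i)) /\
  depth lam ss k 0 n.*2 = 0.

(** Says that [x] and [y] lie in one run of labels at least [k]; the boxes of level [k] over such a
    run will form a tile. [minn] and [maxn] make the relation symmetric. *)
Definition conn k x y :=
  [forall i : 'I_(n.*2), (minn x y <= i < maxn x y) ==> (k <= nth 0 ss i)].
Definition same_tile (c c' : box n) := (level c == level c') && conn (level c) c.1 c'.1.
Definition tiling_of := equivalence_partition same_tile (Defs.skew n lam mu).

Lemma connP k x y : y <= n.*2 -> x <= y ->
  reflect (forall i, x <= i < y -> k <= nth 0 ss i) (conn k x y).
Proof.
move=> Hy Hxy; apply: (iffP forallP) => [H i Hi|H i].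
  have Hi' : i < n.*2 by lia.
  by have := H (Ordinal Hi'); rewrite (minn_idPl Hxy) (maxn_idPr Hxy) /= Hi.
by rewrite (minn_idPl Hxy) (maxn_idPr Hxy); apply/implyP/H.
Qed.

Lemma connC k x y : conn k x y = conn k y x.
Proof. by rewrite /conn minnC maxnC. Qed.

(** Stated for any maximal run, since it is applied both to the classes of [tiling_of] and to the
    tiles of a given tiling. *)
Lemma conn_run k a m x y : x <= n.*2 -> y <= n.*2 -> a + m <= n.*2 -> a <= x <= a + m ->
  (forall i, a <= i <= a + m -> i < n.*2 -> (k <= nth 0 ss i) = (i < a + m)) ->
  (forall i, i.+1 = a -> (k <= nth 0 ss i) = false) ->
  conn k x y = (a <= y <= a + m).
Proof.
move=> Hx Hy Ham Hxa Hlink Hfirst; apply/idP/idP => [|Hya].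
  have [xy|yx] := leqP x y.
    move/(connP _ Hy xy) => H; rewrite (leq_trans _ xy) ?(andP Hxa).1 //= leqNgt; apply/negP => Hgt.
    have := H (a + m); rewrite (andP Hxa).2 Hgt => /(_ isT).
    by rewrite Hlink ?ltnn ?leqnn ?leq_addr // (leq_trans Hgt).
  rewrite connC => /(connP _ Hx (ltnW yx)) H.
  rewrite (leq_trans (ltnW yx)) ?(andP Hxa).2 // andbT leqNgt; apply/negP => Hgt.
  case: a Hgt Hxa Hfirst {Ham Hlink} => // a Hgt /andP[ax _] /(_ a erefl).
  by rewrite H // ax -ltnS Hgt.
have run i : a <= i < a + m -> k <= nth 0 ss i.
  by case/andP=> ai im; rewrite Hlink ?ai ?(ltnW im) // (leq_trans im).
case/andP: Hxa => ax xm; case/andP: Hya => ay ym.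
have [xy|yx] := leqP x y; [|rewrite connC; have {}yx := ltnW yx]; apply/connP => // i /andP[i1 i2];
  by apply: run; rewrite (leq_trans _ i1) // (leq_trans i2).
Qed.

Lemma conn_refl k x : conn k x x.
Proof. by apply/forallP => i; rewrite minnn maxnn; case: leqP => //; lia. Qed.

Lemma conn_trans k x y w : conn k x y -> conn k y w -> conn k x w.
Proof.
move=> /forallP H1 /forallP H2; apply/forallP => i; apply/implyP => Hi.
have := H1 i; have := H2 i.
case: (boolP (minn x y <= i < maxn x y)) => [_ _ //|Ha].
case: (boolP (minn y w <= i < maxn y w)) => [_ //|Hb].
by exfalso; lia.
Qed.

Lemma same_tile_equiv : {in Defs.skew n lam mu & &, equivalence_rel same_tile}.
Proof.
move=> c1 c2 c3 _ _ _; rewrite /same_tile eqxx conn_refl; split=> // /andP[/eqP -> H12].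
case: eqP => //= E; apply/idP/idP => H; last exact: conn_trans H12 H.
by rewrite connC in H12; apply: conn_trans H12 H.
Qed.

Lemma tiling_of_partition : partition tiling_of (Defs.skew n lam mu).
Proof. exact: equivalence_partitionP same_tile_equiv. Qed.

Lemma run_left k x : exists a, [/\ a <= x, forall i, a <= i < x -> k <= nth 0 ss i &
  0 < a -> nth 0 ss a.-1 < k].
Proof.
elim: x => [|x [a [H1 H2 H3]]]; first by exists 0; split=> // i; lia.
have [Hk|Hk] := leqP k (nth 0 ss x); last by exists x.+1; split=> // i; lia.
exists a; split=> //; first by lia.
by move=> i Hi; have [->//|ne] := eqVneq i x; apply: H2; lia.
Qed.

Lemma run_right k x : x <= n.*2 -> exists y, [/\ x <= y <= n.*2, forall i, x <= i < y -> k <= nth 0 ss i &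
  y < n.*2 -> nth 0 ss y < k].
Proof.
move Ed : (n.*2 - x) => d; elim: d x Ed => [|d IH] x Ed Hx.
  by exists x; split; [lia | move=> i; lia | lia].
have [Hk|Hk] := leqP k (nth 0 ss x); last by exists x; split=> // [|i]; lia.
have [||y [H1 H2 H3]] := IH x.+1; [lia | lia |].
exists y; split=> //; first by lia.
by move=> i Hi; have [->//|ne] := eqVneq i x; apply: H2; lia.
Qed.

Definition tile_class c := [set c' in Defs.skew n lam mu | same_tile c c'].

(** The class of [c] lies over the maximal run around its column, and [Slev] makes this run a Dyck
    path: the depth follows [lam] and is 0 at both ends. *)
Lemma tile_class_shape c x : c \in Defs.skew n lam mu -> nat_of_ord c.1 = x ->
  exists a m, shape (tile_class c) a m (level c) /\ a <= x <= a + m.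
Proof.
move=> Hc Ex; have Hx := box_le c; have /andP[k0 kh] := skew_level Hc.
rewrite Ex in Hx kh.
have [a [a1 a2 a3]] := run_left (level c) x.
have [y [y1 y2 y3]] := run_right (level c) Hx.
have s_run i : a <= i < y -> level c <= nth 0 ss i.
  by move=> Hi; have [ic|ci] := ltnP i x; [apply: a2 | apply: y2]; lia.
exists a, (y - a); rewrite subnKC; last by lia.
split; last by lia.
have [Hlt Hend] := Slev k0.
have Hdep i : a + i <= y -> depth lam ss (level c) 0 (a + i) + (a + i) + (U a).*2 = (U (a + i)).*2 + a.
  elim: i => [_|i IH Hi].
    rewrite addn0; have -> : depth lam ss (level c) 0 a = 0.
      case: (a) a3 => //= b; rewrite /depth_step => /(_ isT) Hb.
      by rewrite leqNgt Hb.
    by rewrite add0n addnC.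
  rewrite addnS /= /depth_step s_run; last by lia.
  have := Hlt (a + i) ltac:(lia); rewrite /depth_test s_run; last by lia.
  have := IH ltac:(lia); rewrite nupS ?Hlam; last by lia.
  move: (depth _ _ _ _ _) => e.
  by case: (nth _ _ _) => /=; lia.
split.
- by rewrite subnKC; lia.
- apply/setP => c'; rewrite !inE; apply: andb_id2l => Hc'; rewrite /same_tile eq_sym subnKC; last by lia.
  apply: andb_id2l => _.
  have Hx' := box_le c'; rewrite Ex; move: (nat_of_ord c'.1) Hx' => x' Hx'.
  have E : a + (y - a) = y by rewrite subnKC; lia.
  rewrite -{1}E; apply: conn_run; rewrite ?E //; [lia | lia | |].
    move=> i /andP[ai iy] Hi; have [lt_y|ge_y] := ltnP i y; first by rewrite s_run // ai.
    by have Ei : i = y by [lia]; rewrite Ei leqNgt y3 // -Ei.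
  by move=> i Ei; rewrite leqNgt; case: (a) Ei a3 => // b [->] ->.
(* The gap bound comes from the box [c] in its own column and from the label of an adjacent step of
   the run in any other. *)
- move=> i Hi; rewrite k0 /=.
  have [E|ne] := eqVneq (a + i) x; first by rewrite E.
  have [lt_y|ge_y] := ltnP (a + i) y.
    have [H _] := @Sh (a + i) ltac:(lia).
    by apply: leq_trans H; apply: s_run; lia.
  have [_ H] := @Sh (a + i).-1 ltac:(lia); rewrite prednK in H; last by lia.
  by apply: leq_trans H; apply: s_run; lia.
- by move=> i Hi; have := Hdep i ltac:(lia); lia.
have := Hdep (y - a) ltac:(lia); rewrite subnKC; last by lia.
(* The run stops at [y] either before a step with a smaller label, whose test requires depth 0, or
   at the end of the path. *)
have -> : depth lam ss (level c) 0 y = 0; last by lia.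
have [lt_y|ge_y] := ltnP y n.*2.
  by have := Hlt y lt_y; rewrite /depth_test leqNgt y3 //= => /eqP.
by have -> : y = n.*2 by lia.
Qed.

Lemma tiling_ofP t : reflect (exists2 c, c \in Defs.skew n lam mu & t = tile_class c) (t \in tiling_of).
Proof. exact: imsetP. Qed.

Lemma tiling_of_tiling : dyck_tiling lam mu tiling_of.
Proof.
rewrite /dyck_tiling tiling_of_partition; apply/forall_inP => t /tiling_ofP[c Hc ->].
by have [a [m [Hs _]]] := tile_class_shape Hc erefl; apply: shape_tile Hs.
Qed.

(** A run of labels at least [k] is contained in a run of labels at least [k - 1]. *)
Lemma tiling_of_cover : cover_inclusive lam tiling_of.
Proof.
apply/forall_inP => t /tiling_ofP[c Hc ->]; have [a [m [Hs Hcm]]] := tile_class_shape Hc erefl.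
have [Ham Et Hk _ _] := Hs.
have [k1|kn1] := eqVneq (level c) 1%N; apply/orP; [left|right].
  apply/forall_inP => c'; rewrite Et inE k1 => /and3P[Hc' /eqP Hl _].
  have := skew2 Hc'; rewrite htE ?Hlam ?box_le // Hl.
  by move: (U c'.1) (nat_of_ord c'.1) (nat_of_ord c'.2) => u x y; clear; lia.
have k1 : 1 < level c by have := skew_level Hc; lia.
have Ha : a <= n.*2 by lia.
have Hlx x : a <= x <= a + m -> 0 < level c <= gap x.
  by move=> Hx'; have := Hk (x - a); rewrite subnKC; [apply | ]; lia.
have Hin x : a <= x <= a + m -> box_at x (level c).-1 \in Defs.skew n lam mu.
  by move=> Hx; rewrite box_at_skew; [have := Hlx x Hx | |]; lia.
have Haa : a <= a <= a + m by lia.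
apply/exists_inP; exists (tile_class (box_at a (level c).-1)).
  by apply/tiling_ofP; exists (box_at a (level c).-1) => //; apply: Hin.
apply/forall_inP => c'; rewrite {1}Et inE => /and3P[Hc' /eqP Hl Hx].
have Hx' := box_le c'.
have Hc2 := skew2 Hc'.
have Rac : conn (level c) a c'.1.
  have : box_at a (level c) \in tile_class c by rewrite (mem_shape Hs) ?eqxx //; lia.
  have : c' \in tile_class c by rewrite Et inE Hc' Hl eqxx.
  rewrite !inE => /andP[_ /andP[_ H1]] /andP[_ /andP[_ H2]].
  rewrite (@box_at1 a (level c) Ha) connC in H2.
  exact: conn_trans H2 H1.
rewrite Hl in Hc2.
apply/exists_inP; exists (box_at c'.1 (level c).-1); last first.
  rewrite (@box_at1 c'.1 (level c).-1 Hx') eqxx andTb.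
  have := @box_at2 c'.1 (level c).-1 Hx' _; have := Hlx _ Hx; move: Hc2 k1.
  move: (nat_of_ord (box_at c'.1 (level c).-1).2) => y.
  move: (level c) (U c'.1) (gap c'.1) (nat_of_ord c'.1) (nat_of_ord c'.2) => l u hx x y'.
  move=> E1 l1 /andP[_ l2] E2; have := E2 ltac:(lia); lia.
rewrite inE Hin // /same_tile; have := Hlx _ Haa; have := Hlx _ Hx.
move: (nat_of_ord c'.1) Hx Hx' Rac {Hc2} => x Hx Hx' Rac H1 H2.
rewrite !level_box_at ?eqxx //; try lia.
rewrite (@box_at1 a) // (@box_at1 x) //=.
apply/connP => //; first by lia.
have ax : a <= x by lia.
by move: Rac => /(connP _ Hx' ax) H i Hi; have := H i Hi; lia.
Qed.

Lemma tiling_of_linked i k : i < n.*2 -> 0 < k -> linked tiling_of i k = (k <= nth 0 ss i).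
Proof.
move=> Hi k0; have Hi' := ltnW Hi; apply/(linkedP tiling_of_tiling)/idP.
  case=> t [/tiling_ofP[c Hc ->]]; rewrite inE => /andP[H1 /andP[/eqP E1 H2]].
  rewrite inE => /andP[H3 /andP[_ H4]].
  rewrite box_at_skew // in H1; rewrite box_at_skew // in H3.
  rewrite level_box_at ?k0 // in E1; rewrite E1 in H2 H4.
  rewrite connC (@box_at1 i k Hi') in H2; rewrite (@box_at1 i.+1 k Hi) in H4.
  have /(connP _ Hi (leqnSn i)) := conn_trans H2 H4; apply.
  by rewrite leqnn ltnSn.
move=> Hk; have [h1 h2] := Sh Hi.
have H1 : box_at i k \in Defs.skew n lam mu by rewrite box_at_skew //; apply: leq_trans h1.
have H2 : box_at i.+1 k \in Defs.skew n lam mu by rewrite box_at_skew //; apply: leq_trans h2.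
exists (tile_class (box_at i k)); split.
- by apply/tiling_ofP; exists (box_at i k).
- by rewrite inE H1 /same_tile eqxx conn_refl.
rewrite inE H2 /same_tile !level_box_at ?k0 ?(leq_trans Hk) // eqxx andTb.
rewrite (@box_at1 i k Hi') (@box_at1 i.+1 k Hi).
by apply/connP => // j Hj; have -> : j = i by lia.
Qed.

Lemma label_tiling_of i : i < n.*2 -> label tiling_of i = nth 0 ss i.
Proof.
move=> Hi; have E k : 0 < k -> (k <= label tiling_of i) = (k <= nth 0 ss i).
  by move=> k0; rewrite (label_linked tiling_of_tiling tiling_of_cover) // tiling_of_linked.
apply/eqP; rewrite eqn_leq; apply/andP; split.
  by have [->|s0] := posnP (label tiling_of i); rewrite // -E.
by have [->|s0] := posnP (nth 0 ss i); rewrite // E.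
Qed.

(** Counted by columns; taking the labels for [f] counts the tiles, and 0 counts the boxes. *)
Lemma card_levels (f : nat -> nat) :
  #|[set c in Defs.skew n lam mu | f c.1 < level c]| = \sum_(x < n.*2.+1) (gap x - f x).
Proof.
rewrite -sum1_card (partition_big (fun c : box n => c.1) xpredT) //=.
apply: eq_bigr => x _; rewrite sum1_card -[RHS]card_ord.
have Hx : x <= n.*2 by rewrite -ltnS.
have Hj (j : 'I_(gap x - f x)) : 0 < f x + j.+1 <= gap x by have := ltn_ord j; lia.
rewrite -(card_imset (f := fun j : 'I_(gap x - f x) => box_at x (f x + j.+1))).
  apply: eq_card => c; rewrite -[c \in _]/(_ && _) inE; apply/idP/imsetP.
    move=> /andP[/andP[Hc Hf] /eqP Ex]; have := skew_level Hc; rewrite Ex in Hf * => Hl.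
    have Hlt : level c - (f x).+1 < gap x - f x by lia.
    by exists (Ordinal Hlt) => //=; rewrite {1}(skew_box_at Hc) Ex; congr box_at; lia.
  case=> j _ ->; have Hj' := Hj j.
  have Hs : box_at x (f x + j.+1) \in Defs.skew n lam mu.
    by rewrite box_at_skew //; case/andP: Hj'.
  rewrite Hs (@box_at1 x) // level_box_at // addnS ltnS leq_addr /=.
  by apply/eqP/val_inj; rewrite /= inordK.
move=> j j' E; have := congr1 level E; rewrite !level_box_at // => H.
by apply/val_inj => /=; lia.
Qed.

Lemma card_tiling_of : size ss = n.*2 -> #|tiling_of| = \sum_(x < n.*2.+1) (gap x - nth 0 ss x).
Proof.
move=> Sss; rewrite -(card_levels (nth 0 ss)).
(* Each tile is counted by its rightmost box. *)
have -> : tiling_of = tile_class @: [set c in Defs.skew n lam mu | nth 0 ss c.1 < level c].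
  apply/setP => t; apply/tiling_ofP/imsetP => [[c Hc ->]|[c]]; last first.
    by rewrite inE => /andP[Hc _] ->; exists c.
  have Hx := box_le c; have /andP[k0 kh] := skew_level Hc.
  have [y [/andP[y1 Hy] y2 y3]] := run_right (level c) Hx.
  have hy : 0 < level c <= gap y.
    rewrite k0 /=; have [<-//|ne] := eqVneq (nat_of_ord c.1) y.
    move: y2 ne y1; move: (nat_of_ord c.1) => x y2 ne y1.
    have [_ H] := @Sh y.-1 ltac:(lia); rewrite prednK in H; last by lia.
    by apply: leq_trans H; apply: y2; lia.
  have Hb : box_at y (level c) \in Defs.skew n lam mu by rewrite box_at_skew //; case/andP: hy.
  exists (box_at y (level c)).
    rewrite inE Hb level_box_at // (@box_at1 y) //.
    have [/y3 //|ge_y] := ltnP y n.*2.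
    (* In the last column the default label 0 is below every level. *)
    by rewrite nth_default // Sss.
  have HR : same_tile c (box_at y (level c)).
    by rewrite /same_tile level_box_at // eqxx (@box_at1 y) //; apply/connP.
  apply/setP => c3; rewrite !inE; apply: andb_id2l => H3.
  have H3' : c3 \in Defs.skew n lam mu by rewrite inE.
  by have [_ /(_ HR)] := same_tile_equiv Hc Hb H3'.
rewrite card_in_imset // => c c'; rewrite inE => /andP[Hc Ec]; rewrite inE => /andP[Hc' Ec'] E.
have : c' \in tile_class c by rewrite E inE Hc' /same_tile eqxx conn_refl.
rewrite inE => /andP[_ /andP[/eqP El Hcon]].
apply: skew_inj => //; apply/eqP; rewrite eqn_leq.
have Hx := box_le c; have Hx' := box_le c'.
apply/andP; split; rewrite leqNgt; apply/negP => Hlt.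
  rewrite connC in Hcon; have := (connP _ Hx (ltnW Hlt) Hcon) c'.1.
  by rewrite leqnn Hlt El leqNgt Ec' => /(_ isT).
have := (connP _ Hx' (ltnW Hlt) Hcon) c.1.
by rewrite leqnn Hlt leqNgt Ec => /(_ isT).
Qed.

(** There are as many boxes as the sum of the gaps, and fewer tiles by the sum of the labels; so
    boxes and tiles together number [w.*2]. *)
Lemma art_tiling_of w : size ss = n.*2 ->
  w.*2 + sumn ss = (\sum_(i < n.*2) gap i.+1).*2 -> art tiling_of = w.
Proof.
move=> Sss Hw; rewrite /art -(card_partition tiling_of_partition) card_tiling_of //.
have -> : #|Defs.skew n lam mu| = \sum_(x < n.*2.+1) gap x.
  rewrite -(eq_bigr _ (fun (x : 'I__) _ => subn0 (gap x))) -(card_levels (fun=> 0)).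
  by apply: eq_card => c; rewrite [RHS]inE; case Hc: (c \in _) => //=; have := skew_level Hc; lia.
have Eh : \sum_(x < n.*2.+1) gap x = \sum_(i < n.*2) gap i.+1.
  by rewrite big_ord_recl {1}/gap !nup0 subn0 add0n; apply: eq_bigr.
have Es : \sum_(x < n.*2.+1) (gap x - nth 0 ss x) + sumn ss = \sum_(x < n.*2.+1) gap x.
  have -> : sumn ss = \sum_(x < n.*2.+1) nth 0 ss x.
    rewrite big_ord_recr /= nth_default ?Sss // addn0 sumnE (big_nth 0) Sss big_mkord.
    by [].
  rewrite -big_split /=; apply: eq_bigr => x _; apply: subnK.
  have [Hx|Hx] := ltnP x n.*2; first by case: (Sh Hx).
  by rewrite nth_default // Sss.
move: Es Hw; rewrite Eh.
move: (sumn ss) (\sum_(x < n.*2.+1) _) (\sum_(i < n.*2) _) => a b' c; clear.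
move=> *; have -> : c + b' = w.*2 by lia.
by rewrite doubleK.
Qed.

End Untiling.

(** By [linked_shape] and [linked_shape_first], the columns of a tile of [D] form a maximal run of
    the labels, so the blocks of [D] are the classes of [same_tile]. *)
Lemma tiling_of_labels D : dyck_tiling lam mu D -> cover_inclusive lam D -> tiling_of (labels_of D) = D.
Proof.
move=> HD CD; have /andP[HP _] := HD; have /and3P[/eqP cov _ _] := HP.
rewrite -[RHS](equivalence_partition_pblock HP).
have E c c' : c \in Defs.skew n lam mu -> c' \in Defs.skew n lam mu ->
    same_tile (labels_of D) c c' = (c' \in pblock D c).
  move=> Hc Hc'; have Hct : c \in pblock D c by rewrite mem_pblock cov.
  have HtD : pblock D c \in D by rewrite pblock_mem ?cov.
  have [a [m [k Hs]]] := tiling_shape HD CD HtD.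
  move: (pblock D c) Hct HtD Hs => t Hct HtD Hs.
  have [Ham Et Hk _ _] := Hs.
  move: Hct; rewrite Et inE => /andP[_ /andP[/eqP Ek Hca]].
  rewrite inE Hc' andTb /same_tile Ek eq_sym; apply: andb_id2l => _.
  have k0 : 0 < k by rewrite -Ek; case/andP: (skew_level Hc).
  have Hlink i : a <= i <= a + m -> i < n.*2 -> (k <= nth 0 (labels_of D) i) = (i < a + m).
    move=> Hai Hi; rewrite nth_labels_of // (label_linked HD CD) //.
    exact: (linked_shape HD HtD Hs).
  have Hfirst i : i.+1 = a -> (k <= nth 0 (labels_of D) i) = false.
    move=> Hi; have Hin : i < n.*2 by lia.
    by rewrite nth_labels_of // (label_linked HD CD) // (linked_shape_first HD CD HtD Hs Hi).
  exact: conn_run (box_le c) (box_le c') Ham Hca Hlink Hfirst.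
apply: eq_in_imset => c Hc; apply/setP => c'; rewrite inE [RHS]inE.
by apply: andb_id2l => Hc'; rewrite E.
Qed.
End Boxes.

(** * The bijection between tilings and codes *)

Section Bijection.
Variables (n : nat) (lam : seq bool).
Hypotheses (Hlam : size lam = n.*2) (Dlam : dyck lam).

Local Notation N := n.*2.+1.
Local Notation code := ((n.*2).-tuple (bool * 'I_N)).

Definition upper_path (z : code) : (n.*2).-tuple bool := [tuple of [seq x.1 | x <- z]].
Definition labels (z : code) : seq nat := [seq val x.2 | x <- z].
Definition decode (z : code) : (n.*2).-tuple bool * {set {set box n}} :=
  (upper_path z, tiling_of n lam (upper_path z) (labels z)).
Definition encode (p : (n.*2).-tuple bool * {set {set box n}}) : code :=
  [tuple (tnth p.1 i, inord (label lam p.2 i)) | i < n.*2].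

Lemma unzip1_vals (z : code) : unzip1 (vals z) = upper_path z.
Proof. by rewrite /unzip1 -map_comp. Qed.

Lemma unzip2_vals (z : code) : unzip2 (vals z) = labels z.
Proof. by rewrite /unzip2 -map_comp. Qed.

Lemma size_vals (z : code) : size (vals z) = n.*2.
Proof. by rewrite size_map size_tuple. Qed.

Lemma size_labels (z : code) : size (labels z) = n.*2.
Proof. by rewrite size_map size_tuple. Qed.

Lemma upper_path_encode p : upper_path (encode p) = p.1.
Proof. by apply: eq_from_tnth => i; rewrite tnth_map tnth_mktuple. Qed.

Lemma labels_encode p : labels (encode p) = labels_of lam p.2.
Proof.
apply: (@eq_from_nth _ 0); rewrite size_labels ?size_mkseq // => i Hi.
rewrite nth_mkseq // (nth_map (false, ord0)) ?size_tuple //.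
rewrite -[i]/(val (Ordinal Hi)) -tnth_nth tnth_mktuple /= inordK //.
(* A label is a sum of [n] booleans, so [inord] does not change it. *)
rewrite ltnS; apply: (@leq_trans (\sum_(k < n) 1)).
  by apply: leq_sum => k _; case: linked.
by rewrite sum1_card card_ord; lia.
Qed.

Lemma valid_code_cond (z : code) : valid_code lam (vals z) 0 [::] ->
  let mu := upper_path z in let ss := labels z in
  [/\ above n lam mu, dyck mu,
   forall i, i < n.*2 -> nth 0 ss i <= gap lam mu i /\ nth 0 ss i <= gap lam mu i.+1 &
   forall k, 0 < k ->
    (forall i, i < n.*2 -> depth_test k (nth false lam i) (nth 0 ss i) (depth lam ss k 0 i)) /\
    depth lam ss k 0 n.*2 = 0].
Proof.
have Hsz : size (vals z) = size lam by rewrite size_vals.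
move=> /(@valid_codeP lam (vals z) 0 [::] isT isT Hsz)[/(heights_okP _ Hsz)[H1 H2 H3] H4].
rewrite unzip1_vals unzip2_vals Hlam in H1 H2 H3 H4.
have Hmu : size (upper_path z) = n.*2 by rewrite size_tuple.
have Hab : above n lam (upper_path z) by apply/(aboveP Hlam Hmu) => x /H1.
split=> //.
  apply/dyckP; rewrite Hmu; have [E1 E2] := dyckP _ Dlam; rewrite Hlam in E1 E2.
  split=> [x Hx|]; last by lia.
  by have := H1 x Hx; have := E1 x Hx; lia.
move=> k k0; have Hsl : size (labels z) = size lam by rewrite size_labels.
by have /(level_okP _ _ Hsl) := H4 k k0; rewrite Hlam.
Qed.

(** Reindexing along [decode]: [tiling_of_labels] recovers a tiling from its code, [label_tiling_of]
    recovers a valid code from its tiling, and [code_weightP] matches the weights. *)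
Lemma tiling_gf_codes : tiling_gf n lam =
  (\sum_(z : code | valid_code lam (vals z) 0 [::]) 'X^(code_weight lam (vals z) 0))%R.
Proof.
rewrite /tiling_gf pair_big_dep /= (reindex_onto decode encode) /=; last first.
  move=> [mu D] /= /andP[/andP[Dmu Hab] /andP[HD CD]].
  rewrite /decode upper_path_encode labels_encode; congr pair => /=.
  by apply: tiling_of_labels => //; rewrite size_tuple.
apply: eq_big => [z|z /andP[/andP[/andP[Dmu Hab] /andP[HD CD]] /eqP Ez]].
  apply/idP/idP => [/andP[/andP[/andP[Dmu Hab] /andP[HD CD]] /eqP Ez]|Hok].
    apply: (tiling_valid_code Hlam Dlam _ Dmu Hab HD CD); rewrite ?size_tuple ?size_vals //.
      by rewrite unzip1_vals.
    by rewrite unzip2_vals -{1}Ez labels_encode.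
  have [Hab Dmu Sh Slev] := valid_code_cond Hok.
  have Hmu : size (upper_path z) = n.*2 by rewrite size_tuple.
  rewrite Dmu Hab (tiling_of_tiling Hlam Dlam Hmu Dmu Hab Sh Slev).
  rewrite (tiling_of_cover Hlam Dlam Hmu Dmu Hab Sh Slev) /=.
  apply/eqP; apply: eq_from_tnth => i; rewrite tnth_mktuple /= tnth_map.
  rewrite (label_tiling_of Hlam Dlam Hmu Dmu Hab Sh Slev) //.
  rewrite (nth_map (false, ord0)) ?size_tuple // -tnth_nth inord_val.
  by case: (tnth z i).
have Hok : valid_code lam (vals z) 0 [::].
  apply: (tiling_valid_code Hlam Dlam _ Dmu Hab HD CD); rewrite ?size_tuple ?size_vals //.
    by rewrite unzip1_vals.
  by rewrite unzip2_vals -{1}Ez labels_encode.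
have [_ _ Sh Slev] := valid_code_cond Hok.
have Hmu : size (upper_path z) = n.*2 by rewrite size_tuple.
congr ('X^_)%R; apply: (art_tiling_of Hlam Dlam Hmu Dmu Hab Sh); first exact: size_labels.
by have := code_weightP Hok; rewrite unzip1_vals unzip2_vals Hlam addn0.
Qed.

End Bijection.

(** * Dyck words as words of forests *)

(* [closes j p]: prefixing [j] up steps to [p] gives a Dyck word. *)
Fixpoint closes (j : nat) (p : seq bool) : bool :=
  match p with
  | [::] => j == 0
  | true :: p' => closes j.+1 p'
  | false :: p' => (0 < j) && closes j.-1 p'
  end.

(** The word is cut at the steps that close the [j] pending chords; a preceding up step joins the
    first two pieces into a node. *)
Lemma closes_forest j p : closes j p ->
  exists f (fs : seq forest), size fs = j /\ p = word f ++ flatten [seq false :: word g | g <- fs].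
Proof.
elim: p j => [|[] p IH] j /=.
- by move/eqP->; exists Nil, [::].
- move=> /IH[f [fs [Hs ->]]]; case: fs Hs => // g fs [Hs]; exists (Node f g), fs; split=> //.
  by rewrite /= -!catA.
case: j => //= j /IH[f [fs [Hs ->]]]; exists Nil, (f :: fs).
by split=> //=; rewrite Hs.
Qed.

Lemma dyck_forest p : dyck p -> exists f, p = word f.
Proof.
move=> /dyckP[H1 H2].
suff /closes_forest[f [[|? ?] [// _ ->]]] : closes 0 p by exists f; rewrite cats0.
suff gen j q : (forall x, x <= size q -> x <= (nup q x).*2 + j) ->
    (nup q (size q)).*2 + j = size q -> closes j q.
  by apply: gen => [x /H1|]; rewrite addn0.
elim: q j {p H1 H2} => [|a q IH] j H1 H2; first by apply/eqP; move: H2; rewrite nup0.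
case: a H1 H2 => H1 H2 /=.
  apply: IH => [x Hx|]; first by have := H1 x.+1 Hx; rewrite nup_cons; lia.
  by move: H2; rewrite /= nup_cons; lia.
have j0 : 0 < j by have := H1 1 isT; rewrite nup_cons nup0; lia.
rewrite j0; apply: IH => [x Hx|]; first by have := H1 x.+1 Hx; rewrite nup_cons; lia.
by move: H2; rewrite /= nup_cons; lia.
Qed.

Lemma tiling_gf_word n f : size (word f) = n.*2 -> dyck (word f) -> tiling_gf n (word f) = forest_product f.
Proof.
move=> Hs Hd; rewrite tiling_gf_codes // -word_gf_forest_product -(@sum_valid_codes n.*2.+1) //;
  last by rewrite Hs; lia.
by rewrite Hs.
Qed.

(** * The tree of a Dyck word *)

Lemma nup_cat p q x :
  nup (p ++ q) x = if x <= size p then nup p x else nup p (size p) + nup q (x - size p).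
Proof.
rewrite /nup take_cat take_size; case: ltngtP => // [Hx|->]; first by rewrite count_cat.
by rewrite subnn take0 cats0 take_size.
Qed.

Lemma size_word f : size (word f) = (nchords f).*2.
Proof. by elim: f => //= f1 IH1 f2 IH2; rewrite size_cat /= IH1 IH2; lia. Qed.

Lemma dyck_word f : dyck (word f).
Proof.
apply/dyckP; elim: f => [|f1 [H1 E1] f2 [H2 E2]] /=; first by split=> // x; rewrite leqn0 => /eqP->.
have Sz := size_word f1; have Sz2 := size_word f2.
split=> [[|x] //|]; rewrite size_cat /= nup_cons nup_cat; first move=> Hx.
  case: ifP => [Hx'|/negbT Hx']; first by have := H1 x Hx'; lia.
  have [y Ey] : exists y, x - size (word f1) = y.+1 by exists (x - size (word f1)).-1; lia.
  by rewrite Ey nup_cons /=; have := H2 y ltac:(lia); lia.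
rewrite ifF; last by lia.
by rewrite addKn nup_cons /=; lia.
Qed.

(** After an up step, a path with unit steps that avoids its starting height stays strictly above
    it. *)
Lemma matchedP p i j : reflect
  [/\ i < j < size p, nth false p i /\ ~~ nth false p j,
      (nup p j.+1).*2 + i = (nup p i).*2 + j.+1 &
      forall k, i < k <= j -> (nup p i).*2 + k < (nup p k).*2 + i]
  (matched p i j).
Proof.
apply: (iffP and5P) => [[Hij Hj Hi Hnj /andP[/eqP E /allP H]]|[/andP[Hij Hj] [Hi Hnj] E H]].
  rewrite !htE in E; try lia.
  split=> //; [lia | lia |].
  have Hk k : i < k <= j -> (nup p k).*2 + i != (nup p i).*2 + k.
    move=> Hk; have := H k; rewrite mem_iota => /(_ ltac:(lia)); rewrite !htE; lia.
  elim=> [|k IH] Hki; first by lia.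
  have Hne := Hk k.+1 Hki; rewrite nupS in Hne *; last by lia.
  have [Ei|ne] := eqVneq i k; first by rewrite -Ei Hi /=; lia.
  by have := IH ltac:(lia); case: (nth _ _ _) Hne => /=; lia.
split=> //; apply/andP; split; first by rewrite !htE; [apply/eqP; lia | lia | lia].
by apply/allP => k; rewrite mem_iota => Hk; rewrite !htE; [have := H k; lia | lia | lia].
Qed.

(** [off] is the position of the forest in a surrounding word, so the chords of subforests need no
    translation. *)
Fixpoint chord_list f off : seq (nat * nat) :=
  if f is Node f1 f2 then
    (off, off + (size (word f1)).+1) ::
      chord_list f1 off.+1 ++ chord_list f2 (off + (size (word f1)).+2)
  else [::].

Lemma chord_list_bounds f off c : c \in chord_list f off ->
  off <= c.1 /\ c.1 < c.2 < off + size (word f).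
Proof.
elim: f off => //= f1 IH1 f2 IH2 off; rewrite size_cat /= inE mem_cat.
by case/or3P => [/eqP ->|/IH1|/IH2] /=; lia.
Qed.

Lemma chord_list_uniq f off : uniq (chord_list f off).
Proof.
elim: f off => //= f1 IH1 f2 IH2 off; rewrite cat_uniq IH1 IH2 mem_cat negb_or andbT -!andbA /=.
apply/and3P; split.
- by apply/negP => /chord_list_bounds /=; lia.
- by apply/negP => /chord_list_bounds /=; lia.
by apply/hasPn => c /chord_list_bounds Hc; apply/negP => /chord_list_bounds; lia.
Qed.

Lemma size_chord_list f off : size (chord_list f off) = nchords f.
Proof. by elim: f off => //= f1 IH1 f2 IH2 off; rewrite size_cat IH1 IH2. Qed.

Lemma nup_mid p1 w p2 x : x <= size w ->
  nup (p1 ++ w ++ p2) (size p1 + x) = nup p1 (size p1) + nup w x.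
Proof.
move=> Hx; rewrite nup_cat; case: ifP => H.
  by have -> : x = 0 by [lia]; rewrite addn0 nup0 addn0.
by rewrite addKn nup_cat Hx.
Qed.

(** The surrounding words are arbitrary so that the induction hypotheses apply to the two subforests
    in place. *)
Lemma matched_chord_list f p1 p2 i j : size p1 <= i -> j < size p1 + size (word f) ->
  matched (p1 ++ word f ++ p2) i j = ((i, j) \in chord_list f (size p1)).
Proof.
elim: f p1 p2 i j => [|f1 IH1 f2 IH2] p1 p2 i j Hi Hj.
  rewrite in_nil; apply/negP => /matchedP[]; move: Hj => /=; lia.
have Sz1 := size_word f1; have Sz2 := size_word f2.
have [D1 E1] := dyckP _ (dyck_word f1); have [D2 E2] := dyckP _ (dyck_word f2).
move Es1 : (size (word f1)) => s1; rewrite Es1 in Sz1 D1 E1.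
move E0 : (p1 ++ _ ++ p2) => p.
have Ep : p = rcons p1 true ++ word f1 ++ (false :: word f2 ++ p2).
  by rewrite -E0 -cats1 /= -!catA.
have Ep' : p = (p1 ++ true :: word f1 ++ [:: false]) ++ word f2 ++ p2.
  by rewrite -E0 /= -!catA /= -!catA.
rewrite /= size_cat /= Es1 in Hj.
have S1 : size (rcons p1 true) = (size p1).+1 by rewrite size_rcons.
have S2 : size (p1 ++ true :: word f1 ++ [:: false]) = size p1 + s1.+2.
  by rewrite !size_cat /= size_cat Es1 /=; lia.
have V1 : nup (rcons p1 true) (size p1).+1 = nup p1 (size p1) + 1.
  by rewrite -cats1 nup_cat ltnn subSnn.
have V2 : nup (p1 ++ true :: word f1 ++ [:: false]) (size p1 + s1.+2) = nup p1 (size p1) + 1 + nchords f1.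
  rewrite nup_cat ifF; last by clear; lia.
  rewrite addKn nup_cons nup_cat Es1 ifF; last by clear; lia.
  by rewrite subSnn (_ : nup [:: false] 1 = 0) //=; move: E1 Sz1; clear; lia.
have u1 x : x <= s1 -> nup p ((size p1).+1 + x) = nup p1 (size p1) + 1 + nup (word f1) x.
  by rewrite -Es1 => Hx; rewrite Ep -S1 (nup_mid _ _ Hx) S1 V1.
have u2 : nup p (size p1 + s1.+2) = nup p1 (size p1) + 1 + nchords f1.
  by rewrite -[size p1 + s1.+2]addn0 -{1}S2 Ep' (nup_mid _ _ (leq0n _)) S2 V2 nup0 addn0.
have uoff : nup p (size p1) = nup p1 (size p1) by rewrite -E0 nup_cat leqnn.
have nroot : nth false p (size p1) by rewrite -E0 nth_cat ltnn subnn.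
have nend : nth false p (size p1 + s1.+1) = false.
  by rewrite Ep nth_cat S1 ifF -?addSnnS ?addKn; [rewrite nth_cat Es1 ltnn subnn | clear; lia].
have szp : size p1 + s1.+2 + size (word f2) <= size p.
  by rewrite Ep' size_cat S2 size_cat; clear; lia.
rewrite [chord_list _ _]/= Es1 inE mem_cat.
have IH1' := IH1 (rcons p1 true) (false :: word f2 ++ p2).
have IH2' := IH2 (p1 ++ true :: word f1 ++ [:: false]) p2.
rewrite -Ep S1 Es1 in IH1'; rewrite -Ep' S2 in IH2'.
move: (size p1) Hi Hj {IH1 IH2 E0 Ep Ep' S1 S2 V1 V2} u1 u2 uoff nroot nend szp IH1' IH2'.
move=> off Hi Hj u1 u2 uoff nroot nend szp IH1 IH2.
have Hch1 i' j' : (i', j') \in chord_list f1 off.+1 -> off < i' < j' /\ j' <= off + s1.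
  by move/chord_list_bounds; rewrite /= Es1; lia.
have Hch2 i' j' : (i', j') \in chord_list f2 (off + s1.+2) -> off + s1.+2 <= i' < j'.
  by move/chord_list_bounds => /=; lia.
(* The path stays above its height at [off] until [off + s1.+2]; this first return determines the
   end of the root chord. *)
have high x : off < x <= off + s1.+1 -> (nup p off).*2 + x < (nup p x).*2 + off.
  move=> Hx; have Ex : x = off.+1 + (x - off.+1) by lia.
  by have := D1 (x - off.+1) ltac:(lia); rewrite uoff Ex u1 ?addKn; lia.
have Eroot : matched p off (off + s1.+1).
  apply/matchedP; split; [lia | by rewrite nend nroot | | move=> k Hk; apply: high; lia].
  by rewrite -addnS u2 uoff; lia.
have [Ei|nei] := eqVneq i off.
  have -> : ((i, j) \in chord_list f1 off.+1) = false by apply/negP => /Hch1; lia.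
  have -> : ((i, j) \in chord_list f2 (off + s1.+2)) = false by apply/negP => /Hch2; lia.
  rewrite Ei xpair_eqE eqxx /= !orbF.
  apply/idP/eqP => [/matchedP[H1 H2 H3 H4]|->] //.
  have [lt|gt|//] := ltngtP j (off + s1.+1).
    by have := high j.+1 ltac:(lia); lia.
  by have := H4 (off + s1.+2) ltac:(lia); rewrite u2 uoff; lia.
rewrite xpair_eqE (negbTE nei) andFb orFb.
have [Hi1|Hi1] := leqP i (off + s1).
  have -> : ((i, j) \in chord_list f2 (off + s1.+2)) = false by apply/negP => /Hch2; lia.
  rewrite orbF; have [Hj1|Hj1] := leqP j (off + s1).
    by apply: IH1; lia.
  apply/idP/idP => [/matchedP[H1 H2 H3 H4]|/Hch1]; last by lia.
  (* A chord opened in [f1] cannot end beyond it: at the end of [f1] the path is back at the base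
     height of [f1], not above the start of the chord. *)
  have := H4 (off + s1.+1) ltac:(lia).
  have -> : off + s1.+1 = off.+1 + s1 by lia.
  have Ex : i = off.+1 + (i - off.+1) by lia.
  have Ui : nup p i = nup p1 off + 1 + nup (word f1) (i - off.+1).
    by have := u1 (i - off.+1) ltac:(lia); rewrite -Ex.
  rewrite Ui u1 // => H5; have H6 := D1 (i - off.+1) ltac:(lia); lia.
have -> : ((i, j) \in chord_list f1 off.+1) = false by apply/negP => /Hch1; lia.
rewrite orFb; have [Ei|ne] := eqVneq i (off + s1.+1).
  apply/idP/idP => [/matchedP[_ []]|/Hch2]; last by lia.
  by rewrite Ei nend.
by apply: IH2; lia.
Qed.

Lemma perm_chords f : perm_eq (chords (word f)) (chord_list f 0).
Proof.
apply: uniq_perm; first 1 last.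
- exact: chord_list_uniq.
- move=> [i j]; rewrite mem_filter /= -[word f](cats0 (word f)) -[_ ++ _]/([::] ++ word f ++ [::]).
  have [Hj|Hj] := ltnP j (size (word f)).
    rewrite matched_chord_list //=; case Hin : (_ \in chord_list _ _) => //=.
    apply/allpairsP; exists (i, j); rewrite !mem_iota cats0.
    by have := chord_list_bounds Hin => /=; split=> //; lia.
  transitivity false; first by apply/negP => /andP[/matchedP[]]; rewrite /= cats0; lia.
  by symmetry; apply/negP => /chord_list_bounds /=; lia.
by apply/filter_uniq/allpairs_uniq; rewrite ?iota_uniq // => -[a b] [c d].
Qed.

(** This and [size_in] take the chord list as a parameter, so that they also apply to the chords of
    a subforest. *)
Definition child_list (L : seq (nat * nat)) (v : option (nat * nat)) :=
  match v with
  | None => [seq d <- L | ~~ has (fun c => scontains c d) L]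
  | Some c => [seq d <- L | scontains c d &&
                 ~~ has (fun e => scontains c e && scontains e d) L]
  end.

Definition size_in (L : seq (nat * nat)) d := count (fun e => (e == d) || scontains d e) L.

Definition child_sizes L v := [seq size_in L d | d <- child_list L v].

Lemma child_sizes_perm L L' v : perm_eq L L' -> perm_eq (child_sizes L v) (child_sizes L' v).
Proof.
move=> HL; have Hhas a : has a L = has a L' by apply/perm_has.
rewrite /child_sizes (eq_map (g := size_in L')) => [|d]; last by apply/permP/HL.
apply: perm_map; case: v => [c|] /=.
  rewrite (eq_filter (a2 := fun d => scontains c d &&
     ~~ has (fun e => scontains c e && scontains e d) L')) => [|d]; last by rewrite Hhas.
  exact: perm_filter.
rewrite (eq_filter (a2 := fun d => ~~ has (fun e => scontains e d) L')) => [|d]; last by rewrite Hhas.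
exact: perm_filter.
Qed.

Lemma qmultinom_perm ks ks' : perm_eq ks ks' -> qmultinom ks = qmultinom ks'.
Proof. by move=> H; rewrite /qmultinom (perm_sumn H) (perm_big _ H). Qed.

Lemma qmultinom_short ks : size ks <= 1 -> qmultinom ks = 1%R.
Proof.
have q0 : qmultinom [::] = 1%R by rewrite /qmultinom big_nil /= qfact0 divp1.
by case: ks => [|k [|]] // _; rewrite qmultinom_cons q0 add0n qbinn mulr1.
Qed.

(** Vertices with fewer than two children contribute 1, so the product may run over all vertices. *)
Lemma tree_product_perm p L : perm_eq (chords p) L ->
  tree_product p = (qmultinom (child_sizes L None) *
                    \prod_(c <- L) qmultinom (child_sizes L (Some c)))%R.
Proof.
move=> HL; rewrite /tree_product big_mkcond /=.
have E v : (if 1 < size (children p v)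
      then qmultinom [seq subtree_size p d | d <- children p v] else 1%R) =
    qmultinom (child_sizes L v).
  rewrite -(qmultinom_perm (child_sizes_perm v HL)).
  by case: ltnP => // Hs; rewrite qmultinom_short // size_map.
rewrite (eq_bigr _ (fun v _ => E v)) big_cons big_map; congr (_ * _)%R.
exact: perm_big.
Qed.

Fixpoint root_sizes f := if f is Node f1 f2 then (nchords f1).+1 :: root_sizes f2 else [::].

Lemma sumn_root_sizes f : sumn (root_sizes f) = nchords f.
Proof. by elim: f => //= f1 _ f2 ->. Qed.

(** * Splitting off the leftmost root edge *)

Section Node.
Variables (f1 f2 : forest) (off : nat).
Let r := (off, off + (size (word f1)).+1).
Let L1 := chord_list f1 off.+1.
Let L2 := chord_list f2 (off + (size (word f1)).+2).
Let L := r :: L1 ++ L2.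

Lemma L1_bounds c : c \in L1 -> off < c.1 < c.2 /\ c.2 < r.2.
Proof. by move/chord_list_bounds => /=; lia. Qed.

Lemma L2_bounds c : c \in L2 -> r.2 < c.1 < c.2.
Proof. by move/chord_list_bounds => /=; lia. Qed.

Lemma has_none (T : eqType) (a : pred T) s : {in s, forall x, ~~ a x} -> has a s = false.
Proof. by move=> H; apply/negbTE/hasPn. Qed.

Lemma filter_none (T : eqType) (a : pred T) s : {in s, forall x, ~~ a x} -> filter a s = [::].
Proof. by move=> H; rewrite (eq_in_filter (a2 := pred0)) ?filter_pred0 // => x /H/negbTE. Qed.

Lemma count_none (T : eqType) (a : pred T) s : {in s, forall x, ~~ a x} -> count a s = 0.
Proof. by move=> H; apply/eqP; rewrite -leqn0 leqNgt -has_count has_none. Qed.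

Lemma size_root : size_in L r = (nchords f1).+1.
Proof.
rewrite /size_in /= count_cat eqxx /= (@count_none _ _ L2) => [|e /L2_bounds]; last first.
  by rewrite negb_or /scontains /= -pair_eqE /pair_eq /=; lia.
rewrite addn0 add1n -(size_chord_list f1 off.+1) -/L1; congr _.+1.
rewrite -count_predT; apply: eq_in_count => e /L1_bounds; rewrite /scontains /=; lia.
Qed.

Lemma size_L1 d : d \in L1 -> size_in L d = size_in L1 d.
Proof.
move=> /L1_bounds Hd; rewrite /size_in /= count_cat (@count_none _ _ L2) => [|e /L2_bounds]; last first.
  by rewrite negb_or /scontains /= -pair_eqE /pair_eq /=; move: Hd; rewrite /=; lia.
rewrite addn0 (_ : (_ || _) = false) //.
by move: Hd; rewrite /scontains -pair_eqE /pair_eq /=; lia.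
Qed.

Lemma size_L2 d : d \in L2 -> size_in L d = size_in L2 d.
Proof.
move=> /L2_bounds Hd; rewrite /size_in /= count_cat (@count_none _ _ L1) => [|e /L1_bounds]; last first.
  by rewrite negb_or /scontains /= -pair_eqE /pair_eq /=; move: Hd; rewrite /=; lia.
rewrite add0n (_ : (_ || _) = false) //.
by move: Hd; rewrite /scontains -pair_eqE /pair_eq /=; lia.
Qed.

Lemma child_root : child_list L (Some r) = child_list L1 None.
Proof.
rewrite [child_list L _]/= {1}/scontains ltnn andFb filter_cat (@filter_none _ _ L2) ?cats0.
  apply: eq_in_filter => d Hd; have /L1_bounds Hb := Hd.
  have -> : scontains r d by rewrite /scontains /=; move: Hb => /=; lia.
  rewrite {1}/scontains ltnn /= has_cat; congr (~~ _).
  rewrite (@has_none _ _ L2) ?orbF; first last.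
    by move=> e /L2_bounds; move: Hb; rewrite /scontains /=; lia.
  by apply: eq_in_has => e /L1_bounds; rewrite /scontains /=; lia.
by move=> e /L2_bounds; rewrite /scontains /=; lia.
Qed.

Lemma child_none : child_list L None = r :: child_list L2 None.
Proof.
have C1 d : d \in L1 -> scontains r d by move/L1_bounds; rewrite /scontains /=; lia.
rewrite [child_list L None]/= ifT; last first.
  rewrite has_cat !negb_or; apply/and3P; split.
  - by rewrite /scontains ltnn.
  - by apply/hasPn => e /L1_bounds; rewrite /scontains /=; lia.
  by apply/hasPn => e /L2_bounds; rewrite /scontains /=; lia.
congr cons; rewrite filter_cat (@filter_none _ _ L1) => [|d /C1 ->] //.
apply: eq_in_filter => d /L2_bounds Hd; congr (~~ _).
rewrite has_cat (@has_none _ _ L1) => [|e /L1_bounds]; last by move: Hd; rewrite /scontains /=; lia.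
rewrite (_ : scontains r d = false) //; move: Hd; rewrite /scontains /=; lia.
Qed.

Lemma child_L1 c : c \in L1 -> child_list L (Some c) = child_list L1 (Some c).
Proof.
move=> /L1_bounds Hc; have Cr : scontains c r = false by move: Hc; rewrite /scontains /=; lia.
have C2 d : d \in L2 -> scontains c d = false by move/L2_bounds; move: Hc; rewrite /scontains /=; lia.
rewrite [child_list L _]/= {1}Cr andFb filter_cat (@filter_none _ _ L2) ?cats0 => [|d /C2 ->] //.
apply: eq_in_filter => d Hd; congr (_ && ~~ _).
by rewrite has_cat Cr andFb orFb (@has_none _ _ L2) ?orbF // => e /C2 ->.
Qed.

Lemma child_L2 c : c \in L2 -> child_list L (Some c) = child_list L2 (Some c).
Proof.
move=> /L2_bounds Hc; have Cr : scontains c r = false by move: Hc; rewrite /scontains /=; lia.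
have C1 d : d \in L1 -> scontains c d = false by move/L1_bounds; move: Hc; rewrite /scontains /=; lia.
rewrite [child_list L _]/= {1}Cr andFb filter_cat (@filter_none _ _ L1) ?cat0s => [|d /C1 ->] //.
apply: eq_in_filter => d Hd; congr (_ && ~~ _).
by rewrite has_cat Cr andFb orFb (@has_none _ _ L1) // => e /C1 ->.
Qed.

End Node.

Lemma child_sizes_root f off : child_sizes (chord_list f off) None = root_sizes f.
Proof.
elim: f off => // f1 _ f2 IH off.
rewrite /child_sizes child_none map_cons size_root [RHS]/=; congr cons; rewrite -(IH (off + (size (word f1)).+2)).
by rewrite /child_sizes; apply/eq_in_map => d; rewrite mem_filter => /andP[_ Hd]; apply: size_L2.
Qed.

(** The q-binomial of a node splits its first edge off the root multinomial and leaves that of [f2];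
    the lower end of this edge has the roots of [f1] as its children. *)
Lemma forest_product_chord_list f off : forest_product f = (qmultinom (child_sizes (chord_list f off) None) *
   \prod_(c <- chord_list f off) qmultinom (child_sizes (chord_list f off) (Some c)))%R.
Proof.
elim: f off => [|f1 IH1 f2 IH2] off; first by rewrite big_nil mulr1 qmultinom_short.
rewrite child_sizes_root /= qmultinom_cons sumn_root_sizes big_cons big_cat /=.
set L := _ :: _.
set L1 := chord_list f1 _; set L2 := chord_list f2 _.
have -> : child_sizes L (Some (off, off + (size (word f1)).+1)) = child_sizes L1 None.
  rewrite /child_sizes child_root; apply/eq_in_map => d.
  by rewrite mem_filter => /andP[_ Hd]; apply: size_L1.
rewrite (eq_big_seq (fun c => qmultinom (child_sizes L1 (Some c)))) => [|c Hc]; last first.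
  rewrite /child_sizes child_L1 //; congr qmultinom; apply/eq_in_map => d.
  by rewrite mem_filter => /andP[_ Hd]; apply: size_L1.
rewrite [in X in (_ * (_ * (_ * X)))%R]
  (eq_big_seq (fun c => qmultinom (child_sizes L2 (Some c)))) => [|c Hc]; last first.
  rewrite /child_sizes child_L2 //; congr qmultinom; apply/eq_in_map => d.
  by rewrite mem_filter => /andP[_ Hd]; apply: size_L2.
rewrite (IH1 off.+1) (IH2 (off + (size (word f1)).+2)) -/L1 -/L2 child_sizes_root.
by rewrite (child_sizes_root f2); ring.
Qed.

Lemma tree_product_word f : tree_product (word f) = forest_product f.
Proof. by rewrite (tree_product_perm (perm_chords f)) -forest_product_chord_list. Qed.

Theorem mainTheorem2 (n : nat) (lam : seq bool)
  (Hsize : size lam = n.*2) (Hdyck : dyck lam) :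
  tiling_gf n lam = tree_product lam.
Proof.
have [f Ef] := dyck_forest Hdyck; rewrite Ef in Hsize Hdyck *.
by rewrite tree_product_word tiling_gf_word.
Qed.
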